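(* Let $N\ge 1$ and let $X_1,\dots,X_N$ be independent random variables with $X_i\sim\mathcal N(\mu_i,\sigma_i^2)$, where $\mu_i\in\mathbb R$ and $\sigma_i>0$ are known. Let $T=\max_j \chi^2_{\mathrm{run},j}$, where for the $j$-th success run $A_j$ $$\chi^2_{\mathrm{run},j}=\sum_{i:\,X_i\in A_j}\frac{(X_i-\mu_i)^2}{\sigma_i^2},$$ and let $P(T<t\mid N)$ denote the probability that $T<t$ conditional on there being at least one success among the $N$ observations. Then for every $t>0$, $$P(T<t\mid N)=\sum_{r=1}^{N}\ \sum_{M=1}^{\min(r,\,N-r+1)}\ \sum_{\pi}\ \Bigl(\prod_{l}\Bigl[\frac{\gamma(l/2,\,t/2)}{\Gamma(l/2)}\Bigr]^{n_l}\Bigr)\cdot\frac{(N-r+2-M)_M}{(2^N-1)\,\prod_l n_l!},$$ where the inner sum is over all integer partitions $\pi$ of $r$ into exactly $M$ positive parts, and $n_l=n_l(\pi)$ is the number of parts of $\pi$ equal to $l$.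
   Context: Observations are ordered by the index $i=1,\dots,N$. Observation $i$ is a success if $X_i>\mu_i$ and a failure otherwise. A success run is a maximal block of consecutive indices that are all successes; $A_j$ denotes the observations in the $j$-th success run, and the maximum defining $T$ is over all success runs. The products over $l$ range over $l=1,\dots,N$. For positive integers $x,n$, the Pochhammer symbol is $(x)_n=\Gamma(x+n)/\Gamma(x)=(x+n-1)!/(x-1)!$. The lower incomplete gamma function is $\gamma(a,x)=\int_0^x s^{a-1}e^{-s}\,ds$ and $\Gamma(a)=\int_0^\infty s^{a-1}e^{-s}\,ds$. *)

(* Defs.v *)
From HB Require Import structures.
From mathcomp Require Import all_boot all_order all_algebra.
From mathcomp Require Import all_classical all_reals all_analysis.

Set Implicit Arguments.
Unset Strict Implicit.
Unset Printing Implicit Defensive.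

Import Order.TTheory GRing.Theory Num.Theory.
Import numFieldNormedType.Exports.

Local Open Scope classical_set_scope.
Local Open Scope ring_scope.

Definition mutually_independent (d d' : measure_display)
    (Omega : measurableType d) (E : measurableType d') (R : realType)
    (P : probability Omega R) (I : finType) (X : I -> {RV P >-> E}) : Prop :=
  forall (J : {set I}) (B : I -> set E), (forall i, measurable (B i)) ->
    P (\bigcap_(i in [set` J]) (X i @^-1` B i)) =
    (\prod_(i in J) P (X i @^-1` B i))%E.

(* The two measures are compared on measurable sets only: their values
   elsewhere carry no meaning. *)
Definition normally_distributed (d : measure_display)
    (Omega : measurableType d) (R : realType) (P : probability Omega R)
    (X : {RV P >-> R}) (mu sigma : R) : Prop :=
  forall B : set R, measurable B ->
    distribution P X B = normal_prob mu sigma B.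

Definition cond_prob (d : measure_display) (Omega : measurableType d)
    (R : realType) (P : probability Omega R) (A B : set Omega) : R :=
  fine (P (A `&` B)) / fine (P B).

Section runs.
Context {R : realType} {N : nat}.
Implicit Types (x mu sigma : 'I_N -> R) (A : {set 'I_N}).

Definition success x mu (i : 'I_N) : bool := mu i < x i.

Definition consecutive A : bool :=
  [forall i in A, forall k in A, forall j : 'I_N,
    (i <= j <= k)%N ==> (j \in A)].

Definition success_block x mu A : bool :=
  [&& A != finset.set0, consecutive A & [forall i in A, success x mu i]].

Definition success_run x mu A : bool := maxset (success_block x mu) A.

Definition chi2_run x mu sigma A : R :=
  \sum_(i in A) (x i - mu i) ^+ 2 / sigma i ^+ 2.

(* The default value 0 matters only when there is no success run, since every
   [chi2_run] is nonnegative. *)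
Definition run_stat x mu sigma : R :=
  \big[Num.max/0]_(A : {set 'I_N} | success_run x mu A) chi2_run x mu sigma A.

End runs.

(* Endpoint 0 is left out because [powR] has a conventional value there. *)
Definition Gamma {R : realType} (a : R) : R :=
  \int[lebesgue_measure]_(s in `]0, +oo[) (s `^ (a - 1) * expR (- s)).

Definition lower_gamma {R : realType} (a x : R) : R :=
  \int[lebesgue_measure]_(s in `]0, x]) (s `^ (a - 1) * expR (- s)).

(* Rising factorial (x)_n of a positive integer x. *)
Definition pochhammer {R : realType} (x n : nat) : R :=
  ((x + n).-1)`!%:R / (x.-1)`!%:R.

(* [s] lists the parts of an integer partition of [r], all positive, in
   nonincreasing order. *)
Definition is_intpart (r : nat) (s : seq nat) : bool :=
  [&& sorted geq s, all (fun l => 0 < l)%N s & sumn s == r].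

Definition part_mult (s : seq nat) (l : nat) : nat := count_mem l s.

(* The partitions of [r] into exactly [M] parts, as a finite type: no part
   exceeds [r], so parts range over ['I_r.+1]. *)
Definition sum_intparts {R : realType} (r M : nat) (F : seq nat -> R) : R :=
  \sum_(p : M.-tuple 'I_r.+1 | is_intpart r [seq val l | l <- p])
    F [seq val l | l <- p].

(* Main.v *)
From HB Require Import structures.
Require Import Defs.
From mathcomp Require Import all_boot all_order all_algebra.
From mathcomp Require Import all_classical all_reals all_analysis.
From mathcomp Require Import measurable_realfun ring.

Set Implicit Arguments.
Unset Strict Implicit.
Unset Printing Implicit Defensive.

Import Order.TTheory GRing.Theory Num.Theory.
Import numFieldNormedType.Exports.

Local Open Scope classical_set_scope.
Local Open Scope ring_scope.

(** Fix the set S of successes. The success runs are the maximal blocks of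
    consecutive indices of S; they partition S, so the events that concern
    different runs, and the failures outside S, are independent. Given that
    all observations of a run of length l are successes, its statistic is a
    sum of l squares of independent half-normal variables, that is, a
    chi-squared variable with l degrees of freedom, whose distribution function
    at t is gamma(l/2, t/2) / Gamma(l/2). Hence
    P(S is the set of successes, T < t) is 2^-N times the product of these
    values over the runs of S ([prob_pattern_event]), and dividing the sum over
    nonempty S by P(some success) = 1 - 2^-N gives [cond_prob_runs].

    Two facts carry the probabilistic part. Independence of the observations is
    given as a product rule for rectangles, and uniqueness of measures that
    agree on a pi-system extends it to the sigma-algebras generated by disjoint
    blocks of observations ([g_cylinder_indep]). For the law of a block, the
    convolution of two gamma densities x^(p-1) e^(-x/2) and x^(q-1) e^(-x/2) is
    a constant multiple of x^(p+q-1) e^(-x/2)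
    ([gamma_kernel_convolution]). The constant, a beta integral, is determined
    by the total mass: a block of l observations consists of successes with
    probability 2^-l ([prob_block_lt]).

    The product over the runs depends only on the multiset of run lengths, a
    partition of r = #|S| into M parts, so it remains to count the sets S with a
    given partition ([card_run_lengths]). A set S is encoded by the sequence of
    the N - r + 1 gaps between consecutive failures, where a gap is the number
    of successes in it and may be 0. The sets with a given partition correspond
    to the rearrangements of its parts together with N - r + 1 - M zeros, and
    there are (N-r+1)! / ((N-r+1-M)! prod_l n_l!) of them, which is the
    Pochhammer symbol (N-r+2-M)_M divided by prod_l n_l!. *)

(** * Densities and substitutions for Lebesgue measure *)

Section density.
Local Open Scope ereal_scope.
Context d (T : measurableType d) (R : realType).
Variables (mu : {measure set T -> \bar R}) (h : T -> R).
Hypotheses (mh : measurable_fun setT h) (h0 : forall x, (0 <= h x)%R).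

(** The measurability and nonnegativity of [h] are arguments so that the measure
    structure declared below can be inferred. *)
Definition density of measurable_fun setT h & (forall x, (0 <= h x)%R) :=
  fun A : set T => \int[mu]_(x in A) (h x)%:E.

Local Notation nu := (density mh h0).

Let nu_0 : nu set0 = 0. Proof. exact: integral_set0. Qed.

Let nu_ge0 A : 0 <= nu A. Proof. by apply: integral_ge0 => x _; rewrite lee_fin. Qed.

Let nu_sigma_additive : semi_sigma_additive nu.
Proof.
move=> F mF tF mUF; rewrite /density ge0_integral_bigcup//; last 2 first.
- by apply: measurable_funTS; exact/measurable_EFinP.
- by move=> x _; rewrite lee_fin.
by apply: is_cvg_ereal_nneg_natsum_cond => n _ _; apply: integral_ge0 => x _; rewrite lee_fin.
Qed.

HB.instance Definition _ := isMeasure.Build _ _ _ nu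
  nu_0 nu_ge0 nu_sigma_additive.

Import HBNNSimple.

(** Both sides agree on simple functions by the definition of [density], and
    monotone convergence passes to their increasing limits. *)
Lemma ge0_integral_density (f : T -> \bar R) :
  measurable_fun setT f -> (forall x, 0 <= f x) ->
  \int[nu]_x f x = \int[mu]_x (f x * (h x)%:E).
Proof.
move=> mf f0.
pose g := nnsfun_approx measurableT mf.
have gf x : EFin (g n x) @[n --> \oo] --> f x by exact: cvg_nnsfun_approx.
transitivity (limn (fun n => \int[nu]_x (g n x)%:E)).
  rewrite -monotone_convergence//.
  - by apply: eq_integral => x _; exact/esym/cvg_lim.
  - by move=> n; exact/measurable_EFinP/measurable_funP.
  - by move=> n x _; rewrite lee_fin.
  - by move=> x _ m n mn; rewrite lee_fin; exact/lefP/nd_nnsfun_approx.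
transitivity (limn (fun n => \int[mu]_x ((g n x)%:E * (h x)%:E))); last first.
  rewrite -monotone_convergence//.
  - apply: eq_integral => x _; apply/cvg_lim => //.
    exact: cvgeZr.
  - move=> n; apply: emeasurable_funM; last exact/measurable_EFinP.
    exact/measurable_EFinP/measurable_funP.
  - by move=> n x _; rewrite mule_ge0// lee_fin.
  - by move=> x _ m n mn; rewrite lee_wpmul2r ?lee_fin//;
      exact/lefP/nd_nnsfun_approx.
congr (limn _); apply/funext => n.
transitivity (\sum_(k \in range (g n))
    \int[nu]_x (k * \1_(g n @^-1` [set k]) x)%:E).
  under eq_integral do rewrite fimfunE -fsumEFin//.
  rewrite ge0_integral_fsum//.
  - by move=> y; exact/measurable_EFinP/measurable_funM.
  - by move=> y x _; rewrite nnfun_muleindic_ge0.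
under [RHS]eq_integral => x _.
  rewrite fimfunE -fsumEFin// ge0_mule_fsuml; last first.
    by move=> r; rewrite EFinM nnfun_muleindic_ge0.
  over.
rewrite [RHS]ge0_integral_fsum//; last 2 first.
- move=> y; apply: emeasurable_funM; last exact/measurable_EFinP.
  exact/measurable_EFinP/measurable_funM.
- by move=> y x _; rewrite mule_ge0 ?lee_fin// -lee_fin EFinM nnfun_muleindic_ge0.
apply: eq_fsbigr => r /[!inE] -[x _ <-].
have mgr : measurable (g n @^-1` [set g n x]) by exact: measurable_sfunP.
under [LHS]eq_integral do rewrite EFinM.
rewrite ge0_integralZl//; last 2 first.
- exact/measurable_EFinP.
- by rewrite lee_fin.
under [RHS]eq_integral do rewrite EFinM -muleA.
rewrite [RHS]ge0_integralZl//; last 3 first.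
- by apply: emeasurable_funM; exact/measurable_EFinP.
- by move=> ? _; rewrite mule_ge0// lee_fin.
- by rewrite lee_fin.
congr (_ * _); rewrite integral_indic// setIT /density [LHS]integral_mkcond.
apply: eq_integral => y _; rewrite patchE indicE.
by case: ifPn => _; rewrite ?mul1e ?mul0e.
Qed.
End density.

Section substitution.
Local Open Scope ereal_scope.
Context (R : realType).
Local Notation mu := (@lebesgue_measure R).

(** Lebesgue measure is a times its image under x |-> a x + b, because the two
    measures agree on half-open intervals. *)
Lemma ge0_integral_affine (a b : R) (f : R -> \bar R) : (0 < a)%R ->
  measurable_fun setT f -> (forall x, 0 <= f x) ->
  \int[mu]_x f x = a%:E * \int[mu]_x f (a * x + b)%R.
Proof.
move=> a0 mf f0.
pose phi (x : measurableTypeR R) : measurableTypeR R := (a * x + b)%R.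
have mphi : measurable_fun setT phi.
  by apply: measurable_funD => //; exact: measurable_funM.
pose m0 : {measure set (measurableTypeR R) -> \bar R} :=
  mscale (NngNum (ltW a0)) (pushforward mu phi).
pose m' := m0 mphi.
transitivity (\int[m']_x f x).
  apply: eq_measure_integral => A mA _.
  apply: lebesgue_measure_unique => // X [[p q] _ <-].
  rewrite lebesgue_measure_itv/= -[RHS]/(a%:E * mu (phi @^-1` `]p, q])).
  have -> : phi @^-1` `]p, q] = `]((p - b) / a)%R, ((q - b) / a)%R]%classic.
    apply/seteqP; split => x /=; rewrite !in_itv/= ltr_pdivrMr// ler_pdivlMr//;
    by rewrite /phi mulrC ltrBlDr lerBrDr.
  rewrite lebesgue_measure_itv/= !lte_fin ltr_pM2r ?invr_gt0// ltrD2r.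
  case: ifP => _; last by rewrite mule0.
  rewrite -!EFinD -EFinM; congr EFin.
  by field; rewrite gt_eqF.
rewrite ge0_integral_mscale//= ge0_integral_pushforward//.
Qed.

Lemma square_FTC (p q : R) : (0 <= p)%R -> (p <= q)%R ->
  \int[mu]_(y in `]p, q]) (2 * y)%:E = (q ^+ 2 - p ^+ 2)%:E.
Proof.
move=> p0; rewrite le_eqVlt => /predU1P[<-|pq].
  by rewrite set_itvoc0 integral_set0 subrr.
rewrite integral_itv_obnd_cbnd; last first.
  by apply/measurable_EFinP; exact: measurable_funM.
rewrite (@continuous_FTC2 _ _ (fun y => y ^+ 2)%R)//.
- by apply: continuous_subspaceT => x; apply: cvgM => //; exact: cvg_cst.
- split.
  + by move=> x _; exact: exprn_derivable.
  + by apply: cvg_at_right_filter; exact: exprn_continuous.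
  + by apply: cvg_at_left_filter; exact: exprn_continuous.
- by move=> x _; rewrite derive1E exp_derive expr1 /GRing.scale/= mulr1.
Qed.

(** The density 2 y on the positive half-line is carried by y |-> y^2 to
    Lebesgue measure on the positive half-line. An equality of measures covers
    integrands that are unbounded near 0, such as a gamma density. *)
Lemma ge0_integral_square (f : R -> \bar R) :
  measurable_fun setT f -> (forall x, 0 <= f x) ->
  \int[mu]_(x in `]0%R, +oo[) f x =
  \int[mu]_(y in `]0%R, +oo[) (f (y ^+ 2)%R * (2 * y)%:E).
Proof.
move=> mf f0.
pose h (y : R) : R := if (0 < y)%R then (2 * y)%R else 0%R.
have mh : measurable_fun setT h.
  apply: measurable_fun_ifT => //; exact: measurable_fun_ltr.
have h0 (y : R) : (0 <= h y)%R.
  by rewrite /h; case: ifPn => // /ltW y0; rewrite mulr_ge0.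
pose nu := density (mu : {measure set (measurableTypeR R) -> \bar R}) mh h0.
pose sq (y : measurableTypeR R) : measurableTypeR R := (y ^+ 2)%R.
have msq : measurable_fun setT sq by exact: measurable_funX.
pose m0 : {measure set (measurableTypeR R) -> \bar R} := pushforward nu sq.
pose m2 := m0 msq.
pose m1 : {measure set (measurableTypeR R) -> \bar R} := mrestr mu (measurable_itv `]0%R, +oo[).
have m12 (A : set (measurableTypeR R)) : measurable A -> m1 A = m2 A.
  apply: (@measure_unique _ R (measurableTypeR R) (@ocitv R)
    (fun k => `](- k%:R)%R, k%:R%R]%classic) _ _ _ _ m1 m2) => //.
  - exact: ocitvI.
  - by move=> k; exact: is_ocitv.
  - apply/seteqP; split => // x _; exists (Num.bound `|x|) => //=.
    have := archi_boundP (normr_ge0 x).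
    by rewrite in_itv/= ltr_norml => /andP[-> /ltW].
  - move=> X [[p q] _ <-].
    rewrite -[LHS]/(mu (`]p, q] `&` `]0%R, +oo[))
      -[RHS]/(\int[mu]_(y in sq @^-1` `]p, q]) (h y)%:E).
    (* truncating p at 0 lets square roots be taken without a sign case *)
    have -> : `]p, q] `&` `]0%R, +oo[ = `](Num.max 0 p)%R, q]%classic.
      apply/seteqP; split => x /=; rewrite !in_itv/= andbT gt_max.
        by move=> [/andP[-> ->] ->].
      by move=> /andP[/andP[-> ->] ->].
    transitivity (\int[mu]_(y in `](Num.sqrt (Num.max 0 p))%R, (Num.sqrt q)%R]) (2 * y)%:E).
      rewrite lebesgue_measure_itv/= lte_fin; case: ltP => pq.
        have q0 : (0 <= q)%R by rewrite (le_trans _ (ltW pq))// le_max lexx.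
        rewrite square_FTC ?sqrtr_ge0 ?ler_sqrt// ?(ltW pq)//.
        by rewrite !sqr_sqrtr// le_max lexx.
      by rewrite set_itv_ge ?integral_set0// bnd_simp -leNgt ler_wsqrtr.
    have -> : `](Num.sqrt (Num.max 0 p))%R, (Num.sqrt q)%R]%classic =
        (sq @^-1` `]p, q]) `&` `]0%R, +oo[.
      apply/seteqP; split => y /=; rewrite !in_itv/= andbT /sq.
        move=> /andP[py yq].
        have y0 : (0 < y)%R by rewrite (le_lt_trans _ py)// sqrtr_ge0.
        have q0 : (0 < q)%R by rewrite -sqrtr_gt0 (lt_le_trans y0).
        split=> //; apply/andP; split.
          rewrite (@le_lt_trans _ _ (Num.max 0 p)%R) ?le_max ?lexx ?orbT//.
          rewrite -(@ltr_sqrt _ _ (y ^+ 2)%R) ?exprn_gt0//.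
          by rewrite sqrtr_sqr ger0_norm// ltW.
        by rewrite -(ler_sqrt _ (ltW q0)) sqrtr_sqr ger0_norm// ltW.
      move=> [/andP[py yq] y0]; apply/andP; split.
        rewrite -[ltRHS](ger0_norm (ltW y0)) -sqrtr_sqr ltr_sqrt ?exprn_gt0//.
        by rewrite gt_max exprn_gt0.
      rewrite -[leLHS](ger0_norm (ltW y0)) -sqrtr_sqr ler_sqrt//.
      by rewrite (le_trans _ yq)// sqr_ge0.
    rewrite integral_mkcondr; apply: eq_integral => y _; rewrite patchE /h.
    by rewrite mem_setE/= in_itv/= andbT; case: ifP.
  - move=> k; apply: (@le_lt_trans _ _ (mu `](- k%:R)%R, k%:R%R]%classic)).
      by apply: le_measure; rewrite ?inE//; exact: measurableI.
    by rewrite lebesgue_measure_itv/=; case: ifP => // _; rewrite ltry.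
transitivity (\int[m2]_(x in `]0%R, +oo[) f x).
  apply: eq_measure_integral => A mA A0; rewrite -m12//.
  rewrite /m1/= /mrestr; congr (mu _).
  by apply/esym/setIidPl.
rewrite ge0_integral_pushforward//; last first.
  exact: measurable_funTS.
rewrite [LHS]integral_mkcond ge0_integral_density//; last 2 first.
- apply/(measurable_restrictT _ _).1; last first.
    by apply: measurable_funTS; exact: measurableT_comp.
  by rewrite -[X in measurable X]setTI; apply: (msq measurableT).
- by apply: erestrict_ge0 => x _ /=.
rewrite [RHS]integral_mkcond; apply: eq_integral => y _; rewrite !patchE /h /=.
rewrite [in RHS]mem_setE/= in_itv/= andbT.
case: ltP => [y0|_]; last by rewrite mule0.
by rewrite ifT//; apply/mem_set; rewrite /= in_itv/= andbT exprn_gt0.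
Qed.
End substitution.

(** * Convolution of gamma densities *)

Section gamma_kernel.
Context {R : realType}.
Local Notation mu := (@lebesgue_measure R).
Implicit Types p q x z : R.

(** The density, up to a constant, of the gamma law of shape p and scale 2;
    for p = l / 2 this is the chi-squared law with l degrees of freedom. *)
Definition gamma_kernel p x : R :=
  if 0 < x then x `^ (p - 1) * expR (- (x / 2)) else 0.

Lemma measurable_gamma_kernel p : measurable_fun setT (gamma_kernel p).
Proof.
apply: measurable_fun_ifT => //; first exact: measurable_fun_ltr.
apply: measurable_funM; first exact: measurable_powR.
apply: measurableT_comp => //; apply: measurableT_comp => //.
exact: measurable_funM.
Qed.

Lemma gamma_kernel_ge0 p x : 0 <= gamma_kernel p x.
Proof.
by rewrite /gamma_kernel; case: ifP => // _; rewrite mulr_ge0 ?powR_ge0 ?expR_ge0.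
Qed.

Definition beta_kernel p q v : R :=
  if 0 < v < 1 then v `^ (p - 1) * (1 - v) `^ (q - 1) else 0.

Lemma measurable_beta_kernel p q : measurable_fun setT (beta_kernel p q).
Proof.
apply: measurable_fun_ifT => //.
  by apply: measurable_and; exact: measurable_fun_ltr.
apply: measurable_funM; first exact: measurable_powR.
apply: (measurableT_comp (measurable_powR _)).
exact: measurable_funB.
Qed.

Lemma beta_kernel_ge0 p q v : 0 <= beta_kernel p q v.
Proof.
by rewrite /beta_kernel; case: ifP => // _; rewrite mulr_ge0 ?powR_ge0.
Qed.

(** In the convolution integral, put z = w v: the exponentials combine to a
    factor that depends on w only, and the powers of w separate from those
    of v. *)
Lemma gamma_kernel_beta p q (w v : R) : 0 < w ->
  w * (gamma_kernel p (w * v + 0) * gamma_kernel q (w - (w * v + 0))) =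
  gamma_kernel (p + q) w * beta_kernel p q v.
Proof.
move=> w0; rewrite addr0.
have -> : w - w * v = w * (1 - v) by ring.
rewrite /gamma_kernel /beta_kernel !pmulr_rgt0// w0 subr_gt0.
case: ltP => [v0|_]; last by rewrite mul0r !mulr0.
case: ltP => [v1|_]; last by rewrite !mulr0.
have w1 : w `^ (p + q - 1) = w * (w `^ (p - 1) * w `^ (q - 1)).
  rewrite -{2}[w]powRr1 ?ltW// -!powRD ?(gt_eqF w0) ?implybT//.
  by congr (_ `^ _); ring.
have -> : expR (- (w / 2)) = expR (- (w * v / 2)) * expR (- (w * (1 - v) / 2)).
  by rewrite -expRD; congr expR; field.
rewrite w1 !powRM ?ltW ?subr_gt0//=.
ring.
Qed.

Local Open Scope ereal_scope.

(** The left-hand side is the mass of B under the convolution. After the shift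
    u = w - z and an exchange of integrals, [gamma_kernel_beta] computes the
    inner integral. The beta integral is an extended real, infinite for
    some p and q. *)
Lemma gamma_kernel_convolution p q (B : set R) : measurable B ->
  \int[mu]_z \int[mu]_u
    (\1_B (z + u)%R * (gamma_kernel p z * gamma_kernel q u))%:E =
  \int[mu]_v (beta_kernel p q v)%:E * \int[mu]_(w in B) (gamma_kernel (p + q) w)%:E.
Proof.
move=> mB.
have mg r := @measurable_gamma_kernel r.
have g0 := gamma_kernel_ge0.
transitivity (\int[mu]_z \int[mu]_w
    (\1_B w * (gamma_kernel p z * gamma_kernel q (w - z)))%:E).
  apply: eq_integral => z _.
  rewrite (ge0_integral_affine (- z) ltr01); last 2 first.
  - apply/measurable_EFinP; apply: measurable_funM.
      apply: measurableT_comp; first exact: measurable_indic.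
      exact: measurable_funD.
    exact: measurable_funM.
  - by move=> u; rewrite lee_fin !mulr_ge0.
  rewrite mul1e; apply: eq_integral => w _.
  by rewrite mul1r addrC subrK.
pose F (zw : measurableTypeR R * measurableTypeR R) :=
  (\1_B zw.2 * (gamma_kernel p zw.1 * gamma_kernel q (zw.2 - zw.1)))%:E.
transitivity (\int[mu]_w \int[mu]_z F (z, w)).
  apply: (@fubini_tonelli _ _ _ _ _ mu mu F).
  - apply/measurable_EFinP; apply: measurable_funM.
      by apply: measurableT_comp; first exact: measurable_indic.
    apply: measurable_funM; first exact: (measurableT_comp (mg p)).
    apply: (measurableT_comp (mg q)); exact: measurable_funB.
  - by move=> -[z w]; rewrite /F/= lee_fin !mulr_ge0.
rewrite [X in _ = _ * X]integral_mkcond.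
rewrite -ge0_integralZl//; last 3 first.
- apply/(measurable_restrictT _ _).1 => //; apply: measurable_funTS.
  by apply/measurable_EFinP; apply: mg.
- by move=> x _; apply: erestrict_ge0 => y _; rewrite lee_fin.
- by apply: integral_ge0 => v _; rewrite lee_fin beta_kernel_ge0.
apply: eq_integral => w _; rewrite patchE /F/=.
have [w0|w0] := leP w 0%R.
  rewrite integral0_eq => [|z _].
    by case: ifP => _; rewrite ?mule0// /gamma_kernel ltNge w0 mule0.
  rewrite /gamma_kernel; case: (ltP 0%R z) => z0; last by rewrite mul0r mulr0.
  by rewrite ifF ?mulr0// subr_gt0; apply/negbTE; rewrite -leNgt (le_trans w0)// ltW.
rewrite (ge0_integral_affine 0 w0); last 2 first.
- apply/measurable_EFinP; apply: measurable_funM => //.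
  by apply: measurable_funM => //; apply: (measurableT_comp (mg q)); exact: measurable_funB.
- by move=> u; rewrite lee_fin !mulr_ge0.
rewrite -ge0_integralZl//; last 3 first.
- apply/measurable_EFinP; apply: measurable_funM => //.
  have mw : measurable_fun setT (fun x => w * x + 0)%R.
    by apply: measurable_funD => //; exact: measurable_funM.
  apply: measurable_funM; first exact: (measurableT_comp (mg p)).
  by apply: (measurableT_comp (mg q)); exact: measurable_funB.
- by move=> u _; rewrite lee_fin !mulr_ge0.
- by rewrite lee_fin ltW.
rewrite indicE.
transitivity (\int[mu]_v (((w \in B)%:R * gamma_kernel (p + q) w)%:E *
   (beta_kernel p q v)%:E)).
  apply: eq_integral => v _.
  by rewrite -!EFinM mulrCA gamma_kernel_beta// mulrA.
rewrite ge0_integralZl//; last 3 first.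
- by apply/measurable_EFinP; apply: measurable_beta_kernel.
- by move=> u _; rewrite lee_fin beta_kernel_ge0.
- by rewrite lee_fin mulr_ge0.
rewrite muleC; congr (_ * _).
by case: ifP => _; rewrite ?mul1r ?mul0r.
Qed.

(** The substitution x = 2 s leads to the integrand of the Gamma function. *)
Lemma integral_gamma_kernel p (E : set R) : measurable E ->
  \int[mu]_(x in E) (gamma_kernel p x)%:E =
  (2 `^ p)%:E * \int[mu]_(s in [set s | E (2 * s)%R] `&` `]0%R, +oo[)
    (s `^ (p - 1) * expR (- s))%:E.
Proof.
move=> mE; rewrite integral_mkcond.
have mg := @measurable_gamma_kernel p.
have mf : measurable_fun setT
    ((fun x => (gamma_kernel p x)%:E) \_ E : measurableTypeR R -> \bar R).
  by apply/(measurable_restrictT _ _).1 => //; apply: measurable_funTS;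
    apply/measurable_EFinP; apply: mg.
rewrite (ge0_integral_affine 0 (ltr0Sn R 1) mf); last first.
  by move=> x; apply: erestrict_ge0 => y _; rewrite lee_fin gamma_kernel_ge0.
rewrite [in RHS]integral_mkcond.
rewrite -[p in (2 `^ p)%R](subrK 1%R).
rewrite powRD; last by rewrite pnatr_eq0 implybT.
rewrite powRr1// [in RHS]mulrC EFinM -muleA; congr (_ * _).
have mh : measurable_fun setT
    (fun s : measurableTypeR R => (s `^ (p - 1) * expR (- s))%:E).
  apply/measurable_EFinP; apply: measurable_funM; first exact: measurable_powR.
  by apply: measurableT_comp => //; exact: measurableT_comp.
have m2 : measurable [set s : measurableTypeR R | E (2 * s)%R].
  rewrite -[X in measurable X]setTI.
  exact: (@mulrl_measurable R setT 2%R measurableT E mE).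
rewrite -ge0_integralZl//; last 2 first.
- apply/(measurable_restrictT _ _).1; first exact: measurableI.
  exact: measurable_funTS.
- move=> x _; apply: erestrict_ge0 => y _.
  by rewrite lee_fin mulr_ge0 ?powR_ge0 ?expR_ge0.
apply: eq_integral => s _; rewrite addr0 !patchE in_setI.
have -> : (s \in [set s | E (2 * s)%R]) = ((2 * s)%R \in E).
  by apply/idP/idP => /set_mem ?; exact/mem_set.
case: ifP => _ //=; last by rewrite mule0.
rewrite mem_setE in_itv/= andbT /gamma_kernel pmulr_rgt0//.
case: ltP => s0; last by rewrite mule0.
rewrite powRM ?ltW// -EFinM mulrA; congr (_ * expR _)%:E.
by field.
Qed.
End gamma_kernel.

(** * The square of a half-normal variable *)

Section half_normal.
Context {R : realType}.
Local Notation mu := (@lebesgue_measure R).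
Variables (m s : R).
Hypothesis s0 : 0 < s.

Lemma normal_pdf_standardize (y : R) :
  normal_pdf m s (s * y + m) = normal_peak s * expR (- (y ^+ 2 / 2)).
Proof.
rewrite normal_pdfE ?gt_eqF// /normal_fun; congr (_ * expR _).
by field; rewrite gt_eqF.
Qed.

Local Open Scope ereal_scope.

Lemma normal_prob_standardize (D : set R) : measurable D ->
  normal_prob m s D = (s * normal_peak s)%:E *
    \int[mu]_(y in [set y | D (s * y + m)%R]) (expR (- (y ^+ 2 / 2)))%:E.
Proof.
move=> mD.
have mS : measurable_fun setT (fun y : measurableTypeR R => s * y + m : measurableTypeR R)%R.
  by apply: measurable_funD => //; exact: measurable_funM.
have mSD : measurable [set y : measurableTypeR R | D (s * y + m)%R].
  by rewrite -[X in measurable X]setTI; apply: (mS measurableT).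
have me : measurable_fun setT (fun y : measurableTypeR R => (expR (- (y ^+ 2 / 2)))%:E).
  apply/measurable_EFinP; apply: measurableT_comp => //; apply: measurableT_comp => //.
  by apply: measurable_funM => //; exact: measurable_funX.
rewrite /normal_prob [LHS]integral_mkcond.
rewrite (ge0_integral_affine m s0); last 2 first.
- apply/(measurable_restrictT _ _).1 => //; apply: measurable_funTS.
  apply/measurable_EFinP; exact: measurable_normal_pdf.
- by move=> x; apply: erestrict_ge0 => y _; rewrite lee_fin normal_pdf_ge0.
rewrite EFinM -muleA; congr (_ * _).
rewrite -ge0_integralZl//; last 2 first.
- exact: measurable_funTS.
- by rewrite lee_fin normal_peak_ge0.
rewrite [RHS]integral_mkcond; apply: eq_integral => y _; rewrite !patchE.
have -> : (y \in [set y | D (s * y + m)%R]) = ((s * y + m)%R \in D).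
  by apply/idP/idP => /set_mem ?; exact/mem_set.
by rewrite normal_pdf_standardize EFinM.
Qed.

(** By evenness of the standard Gaussian density. *)
Lemma normal_prob_gt_mean : normal_prob m s [set x | (m < x)%R] = 2^-1%:E.
Proof.
have mE : measurable [set x : R | (m < x)%R] by rewrite -set_itvoy.
have ce : continuous (fun y : R => expR (- (y ^+ 2 / 2)))%R.
  move=> y; apply: continuous_comp; last exact: continuous_expR.
  apply: continuousN; apply: continuousM; last exact: cvg_cst.
  exact: exprn_continuous.
have me : measurable_fun setT (fun y : measurableTypeR R => (expR (- (y ^+ 2 / 2)))%:E).
  by apply/measurable_EFinP; exact: continuous_measurable_fun.
have : (s * normal_peak s)%:E * \int[mu]_y (expR (- (y ^+ 2 / 2)))%:E = 1.
  rewrite -(probability_setT (normal_prob m s)).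
  rewrite [RHS](normal_prob_standardize measurableT).
  by congr (_ * integral _ _ _); apply/esym/seteqP; split.
rewrite ge0_symfun_integralT//; last first.
  by move=> x /=; rewrite sqrrN.
rewrite muleCA normal_prob_standardize//.
have -> : [set y | (m < s * y + m)%R] = `]0%R, +oo[%classic.
  by apply/seteqP; split => y /=; rewrite in_itv/= andbT ltrDr pmulr_rgt0.
rewrite -set_itvcy integral_itv_obnd_cbnd; last exact: measurable_funTS.
set I := _ * integral _ _ _ => h.
have : 2^-1%:E * (2%:E * I) = 2^-1%:E by rewrite h mule1.
by rewrite muleA -EFinM mulVf// mul1e.
Qed.

(** On the event X > m the standardized square is a one-to-one function of X,
    so its law is given by the substitution u = y^2. *)
Lemma normal_prob_half_square (B : set R) : measurable B ->
  normal_prob m s [set x | (m < x)%R /\ B ((x - m) ^+ 2 / s ^+ 2)%R] =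
  (s * normal_peak s / 2)%:E * \int[mu]_(u in B) (gamma_kernel 2^-1 u)%:E.
Proof.
move=> mB.
have mQ : measurable_fun setT (fun x : R => (x - m) ^+ 2 / s ^+ 2)%R.
  by apply: measurable_funM => //; apply: measurable_funX; exact: measurable_funB.
have mE : measurable [set x | (m < x)%R /\ B ((x - m) ^+ 2 / s ^+ 2)%R].
  rewrite -[X in measurable X]/([set x | (m < x)%R] `&` (fun x => (x - m) ^+ 2 / s ^+ 2)%R @^-1` B).
  apply: measurableI; first by rewrite -set_itvoy.
  by rewrite -[X in measurable X]setTI; apply: mQ.
rewrite normal_prob_standardize//= [in RHS]EFinM -muleA; congr (_ * _).
have mg := @measurable_gamma_kernel R 2^-1.
rewrite -ge0_integralZl//; last 2 first.
- by apply: measurable_funTS; apply/measurable_EFinP; apply: mg.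
- by move=> u _; rewrite lee_fin gamma_kernel_ge0.
pose F (u : R) := ((fun u => (2^-1)%:E * (gamma_kernel 2^-1 u)%:E) \_ B) u.
transitivity (\int[mu]_(u in `]0%R, +oo[) F u); last first.
  rewrite [LHS]integral_mkcond [RHS]integral_mkcond; apply: eq_integral => u _.
  rewrite /F !patchE mem_setE/= in_itv/= andbT.
  case: ltP => // u0; rewrite /gamma_kernel ltNge u0 mule0.
  by case: ifP.
rewrite ge0_integral_square; last 2 first.
- apply/(measurable_restrictT _ _).1 => //; apply: measurable_funTS.
  by apply: measurable_funeM; apply/measurable_EFinP; apply: mg.
- by apply: erestrict_ge0 => u _; rewrite -EFinM lee_fin mulr_ge0 ?gamma_kernel_ge0.
rewrite [LHS]integral_mkcond [RHS]integral_mkcond; apply: eq_integral => y _.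
rewrite /F !patchE [in RHS]mem_setE/= in_itv/= andbT.
have -> : (y \in [set y | (m < s * y + m)%R /\ B ((s * y + m - m) ^+ 2 / s ^+ 2)%R]) =
    (0 < y)%R && ((y ^+ 2)%R \in B).
  have -> : [set y | (m < s * y + m)%R /\ B ((s * y + m - m) ^+ 2 / s ^+ 2)%R] =
     [set y | (0 < y)%R /\ B (y ^+ 2)%R].
    apply/seteqP; split => z /=; rewrite ltrDr pmulr_rgt0// addrK;
      by rewrite exprMn mulrAC divff ?mul1r// sqrf_eq0 gt_eqF.
  by apply/idP/idP => [/set_mem[-> ?]|/andP[? /set_mem ?]]; exact/mem_set.
case: ltP => [y0|//]/=; case: ifP => _; last by rewrite mul0e.
rewrite -!EFinM /gamma_kernel exprn_gt0//.
have -> : ((y ^+ 2) `^ (2^-1 - 1) = y^-1)%R.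
  rewrite -powR_mulrn ?ltW// -powRrM -(powR_inv1 (ltW y0)); congr (_ `^ _)%R.
  by field.
congr EFin; field.
by rewrite gt_eqF.
Qed.
End half_normal.

(** * Independence of disjoint blocks of observations *)

Section block_independence.
Context d d' (Omega : measurableType d) (E : measurableType d') (R : realType).
Context (P : probability Omega R) (I : finType) (X : I -> {RV P >-> E}).
Implicit Types A : {set I}.

(** The pi-system that generates the sigma-algebra of the block of variables
    [X i], i in [A]. *)
Definition cylinder A : set (set Omega) :=
  [set F | exists2 B : I -> set E, forall i, measurable (B i) &
    F = \bigcap_(i in [set` A]) (X i @^-1` B i)].

Lemma measurable_preimage_RV (Y : {RV P >-> E}) (B : set E) :
  measurable B -> measurable (Y @^-1` B).
Proof. by move=> mB; rewrite -[X in measurable X]setTI; exact: measurable_funP. Qed.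

Lemma cylinder_measurable A : cylinder A `<=` measurable.
Proof.
move=> _ [B mB ->]; apply: fin_bigcap_measurable => // i _.
exact: measurable_preimage_RV.
Qed.

Lemma cylinder_setI A : setI_closed (cylinder A).
Proof.
move=> _ _ [B mB ->] [C mC ->]; exists (fun i => B i `&` C i).
  by move=> i; exact: measurableI.
by rewrite -bigcapI; apply: eq_bigcapr => i _; rewrite preimage_setI.
Qed.

Lemma cylinder_setT A : cylinder A setT.
Proof.
by exists (fun=> setT) => //; apply/esym/seteqP; split.
Qed.

Lemma g_cylinder_measurable A : <<s cylinder A >> `<=` measurable.
Proof.
apply: smallest_sub; last exact: cylinder_measurable.
exact: sigma_algebra_measurable.
Qed.

Lemma cylinder_preimage A i (B : set E) : i \in A -> measurable B ->
  cylinder A (X i @^-1` B).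
Proof.
move=> iA mB; exists (fun j => if j == i then B else setT).
  by move=> j; case: ifP.
apply/seteqP; split => w /=.
  by move=> Bw j _ /=; case: eqP => [->|].
by move=> /(_ i iA) /=; rewrite eqxx.
Qed.

Hypothesis indepX : mutually_independent X.
Local Open Scope ereal_scope.

Lemma cylinder_indep A A' F F' : [disjoint A & A']%B ->
  cylinder A F -> cylinder A' F' -> P (F `&` F') = P F * P F'.
Proof.
move=> AA' [B mB ->] [C mC ->].
rewrite !indepX//.
pose D i := if i \in A then B i else C i.
have -> : \bigcap_(i in [set` A]) (X i @^-1` B i) `&`
    \bigcap_(i in [set` A']) (X i @^-1` C i) =
    \bigcap_(i in [set` (A :|: A')%SET]) (X i @^-1` D i).
  apply/seteqP; split => w /=.
    move=> [wB wC] i /=; rewrite inE /D; case: ifPn => [iA _|_ /= iA'].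
      exact: wB.
    exact: wC.
  move=> wD; split => i /= iA.
    by have := wD i; rewrite /= inE /D iA; apply.
  have := wD i; rewrite /= inE /D iA orbT (disjointFl AA' iA).
  by apply.
rewrite indepX; last by move=> i; rewrite /D; case: ifP.
rewrite (eq_bigl _ _ (fun i => finset.in_setU i A A')) bigU//=.
congr (_ * _); apply: eq_bigr => i iA; rewrite /D ?iA//.
by rewrite (disjointFl AA').
Qed.

(** For a fixed event of one block, the two sides are finite measures in the
    event of the other block, so that equality extends from the pi-system of
    cylinders to the sigma-algebra; this is done for one block, then for the
    other. *)
Lemma g_cylinder_indep A A' F F' : [disjoint A & A']%B ->
  <<s cylinder A >> F -> <<s cylinder A' >> F' -> P (F `&` F') = P F * P F'.
Proof.
move=> AA'.
have half A0 (F0 F1 : set Omega) : measurable F1 ->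
    (forall F, cylinder A0 F -> P (F `&` F1) = P F * P F1) ->
    <<s cylinder A0 >> F0 -> P (F0 `&` F1) = P F0 * P F1.
  move=> mF1 h sF0.
  have PF1 : P F1 = (fine (P F1))%:E by rewrite fineK// fin_num_measure.
  have PF10 : (0 <= fine (P F1))%R by rewrite fine_ge0.
  rewrite muleC PF1.
  pose m1 : {measure set Omega -> \bar R} := mrestr P mF1.
  pose m2 : {measure set Omega -> \bar R} := mscale (NngNum PF10) P.
  apply: (@g_sigma_algebra_measure_unique _ _ _ (cylinder A0) (@cylinder_measurable A0)
    (fun=> setT) _ _ m1 m2) => //.
  - by move=> n; exact: cylinder_setT.
  - by rewrite bigcup_const.
  - exact: cylinder_setI.
  - move=> G /h GE; rewrite /m1 /m2/= /mrestr /mscale/= GE.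
    by rewrite -PF1 muleC.
  - by move=> k; rewrite /m1/= /mrestr (le_lt_trans (probability_le1 _ _))
      ?ltry//; exact: measurableI.
move=> sF sF'; apply: (half A) => //; first exact: (g_cylinder_measurable sF').
move=> G cG; rewrite setIC muleC; apply: (half A') => //.
  exact: cylinder_measurable cG.
by move=> G' cG'; rewrite setIC muleC; exact: cylinder_indep cG cG'.
Qed.

Lemma g_cylinder_sub A A' : A \subset A' ->
  <<s cylinder A >> `<=` <<s cylinder A' >>.
Proof.
move=> sAA'; apply: sub_smallest2r => [|_ [B mB ->]]; first exact: smallest_sigma_algebra.
exists (fun i => if i \in A then B i else setT).
  by move=> i; case: ifP.
apply/seteqP; split => w wB i /= iA.
  by case: ifPn => // iA0; exact: wB.
by have := wB i; rewrite /= iA; apply; exact: (fintype.subsetP sAA').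
Qed.

(** By induction: the intersection over the tail of [r] is an event of the
    union of the remaining blocks, which is disjoint from the first one. *)
Lemma g_cylinder_indep_bigcap (J : eqType) (r : seq J) (A : J -> {set I})
    (F : J -> set Omega) : uniq r ->
  {in r &, forall j k, j != k -> [disjoint A j & A k]%B} ->
  (forall j, j \in r -> <<s cylinder (A j) >> (F j)) ->
  P (\bigcap_(j in [set` r]) F j) = \prod_(j <- r) P (F j).
Proof.
elim: r => [_ _ _|j r IH /= /andP[jr ur] disj sF].
  by rewrite set_nil bigcap_set0 probability_setT big_nil.
have -> : \bigcap_(k in [set` j :: r]) F k =
    F j `&` \bigcap_(k in [set` r]) F k.
  rewrite -bigcap_setU1; congr (bigcap _ _); apply/seteqP.
  by split=> k /= /[!inE] => [/predU1P|kr]; last apply/predU1P.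
rewrite big_cons -IH//; last 2 first.
- by move=> k l kr lr; apply: disj; rewrite inE ?kr ?lr orbT.
- by move=> k kr; apply: sF; rewrite inE kr orbT.
pose U := [set i | has (fun k => i \in A k) r]%SET.
apply: (@g_cylinder_indep (A j) U).
- rewrite disjoint_subset; apply/fintype.subsetP => i ij; rewrite !inE.
  apply/hasPn => k kr.
  by rewrite (disjointFr (disj j k _ _ _) ij)// ?mem_head ?inE ?kr ?orbT//;
    apply: contra jr => /eqP ->.
- by apply: sF; rewrite mem_head.
- apply: (@fin_bigcap_measurable _ (g_sigma_algebraType (cylinder U))) => // k /= kr.
  apply: (@g_cylinder_sub (A k)); last by apply: sF; rewrite inE kr orbT.
  by apply/fintype.subsetP => i ik; rewrite inE; apply/hasP; exists k.
Qed.
End block_independence.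

(** * Law of the chi-squared sum of a block of successes *)

Section block_law.
Context (R : realType) (d : measure_display) (Omega : measurableType d).
Context (P : probability Omega R) (N : nat) (mu sigma : 'I_N -> R).
Hypothesis sigma_gt0 : forall i, 0 < sigma i.
Variable X : 'I_N -> {RV P >-> R}.
Hypothesis indepX : mutually_independent X.
Hypothesis normalX : forall i, normally_distributed (X i) (mu i) (sigma i).
Local Notation leb := (@lebesgue_measure R).
Implicit Types (A : {set 'I_N}) (B : set R).

Definition all_succeed A : set Omega := [set w | forall i, i \in A -> mu i < X i w].

Definition chi2_block A (w : Omega) : R := chi2_run (fun i => X i w) mu sigma A.

Local Open Scope ereal_scope.

Lemma all_succeed_cylinder A : <<s cylinder X A >> (all_succeed A).
Proof.
apply: sub_sigma_algebra; exists (fun i => [set x | (mu i < x)%R]) => [i|].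
  by rewrite -set_itvoy.
by [].
Qed.

Lemma measurable_RV_cylinder A i : i \in A ->
  measurable_fun setT (X i : g_sigma_algebraType (cylinder X A) -> R).
Proof.
move=> iA _ B mB; rewrite setTI; apply: sub_sigma_algebra.
exact: cylinder_preimage.
Qed.

Lemma measurable_chi2_block A :
  measurable_fun setT (chi2_block A : g_sigma_algebraType (cylinder X A) -> R).
Proof.
pose h (i : 'I_N) (w : g_sigma_algebraType (cylinder X A)) : R :=
  if i \in A then ((X i w - mu i) ^+ 2 / sigma i ^+ 2)%R else 0%R.
have -> : chi2_block A = fun w => (\sum_(i < N) h i w)%R.
  by apply/funext => w; rewrite /chi2_block /chi2_run big_mkcond.
apply: measurable_sum => i; rewrite /h; have [iA|_] := boolP (i \in A); last exact: measurable_cst.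
apply: measurable_funM => //; apply: measurable_funX.
by apply: measurable_funB => //; exact: measurable_RV_cylinder.
Qed.

Lemma chi2_block_cylinder A B : measurable B ->
  <<s cylinder X A >> (chi2_block A @^-1` B).
Proof.
by move=> mB; have := @measurable_chi2_block A measurableT B mB; rewrite setTI.
Qed.

Lemma prob_success i : P (X i @^-1` [set x | (mu i < x)%R]) = 2^-1%:E.
Proof.
have := normalX i (B := [set x | (mu i < x)%R]).
rewrite /distribution /pushforward => ->; last by rewrite -set_itvoy.
exact: normal_prob_gt_mean.
Qed.

Lemma prob_all_succeed A : P (all_succeed A) = (2^-1 ^+ #|A|)%:E.
Proof.
rewrite -[LHS]/(P (\bigcap_(i in [set` A]) (X i @^-1` [set x | (mu i < x)%R]))).
rewrite indepX; last by move=> i; rewrite -set_itvoy.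
rewrite (eq_bigr (fun=> 2^-1%:E)); last by move=> i _; exact: prob_success.
by rewrite prodEFin prodr_const.
Qed.

(** On the success of the whole block, the chi-squared sum has the gamma density
    of shape [p] up to the constant [k]. *)
Definition block_law_for (k : \bar R) (p : R) A :=
  forall B, measurable B ->
    P (all_succeed A `&` chi2_block A @^-1` B) =
    k * \int[leb]_(u in B) (gamma_kernel p u)%:E.

(** The total mass of the law is 2^-#|A|, which is finite and nonzero. *)
Lemma block_law_finite k p A : 0 <= k -> block_law_for k p A ->
  exists2 k' : R, (0 <= k')%R & k = k'%:E.
Proof.
move=> k0 law; have := law setT measurableT.
rewrite preimage_setT setIT prob_all_succeed.
case: k k0 {law} => [k||]//; first by rewrite lee_fin => k0 _; exists k.
move=> _.
have : 0 <= \int[leb]_u (gamma_kernel p u)%:E.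
  by apply: integral_ge0 => u _; rewrite lee_fin gamma_kernel_ge0.
rewrite le_eqVlt => /predU1P[<-|I0].
  rewrite mule0 => -[] /eqP.
  by rewrite expf_eq0 invr_eq0 pnatr_eq0 andbF.
by rewrite gt0_mulye.
Qed.

Lemma block_law1 i : exists2 k, 0 <= k & block_law_for k 2^-1 [set i]%SET.
Proof.
exists (sigma i * normal_peak (sigma i) / 2)%:E.
  by rewrite lee_fin !mulr_ge0 ?normal_peak_ge0 ?ltW.
move=> B mB; rewrite -(normal_prob_half_square (mu i))//.
have mE : measurable
    [set x | (mu i < x)%R /\ B ((x - mu i) ^+ 2 / sigma i ^+ 2)%R].
  rewrite -[X in measurable X]/([set x | (mu i < x)%R] `&`
    (fun x => (x - mu i) ^+ 2 / sigma i ^+ 2)%R @^-1` B).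
  apply: measurableI; first by rewrite -set_itvoy.
  rewrite -[X in measurable X]setTI.
  have mQ : measurable_fun setT (fun x : R => (x - mu i) ^+ 2 / sigma i ^+ 2)%R.
    by apply: measurable_funM => //; apply: measurable_funX; exact: measurable_funB.
  exact: mQ.
rewrite -normalX//; congr (P _); apply/seteqP.
rewrite /all_succeed /chi2_block /chi2_run; split => w /=.
  rewrite big_set1 => -[h ?]; split => //; apply: h; exact: set11.
by rewrite big_set1 => -[h ?]; split => // j /set1P ->.
Qed.

Lemma chi2_block_gt0 A w : A != finset.set0 -> all_succeed A w ->
  (0 < chi2_block A w)%R.
Proof.
move=> /set0Pn[i iA] Aw; rewrite /chi2_block /chi2_run (bigD1 i)//=.
rewrite ltr_wpDr//; first by apply: sumr_ge0 => j _; rewrite divr_ge0 ?sqr_ge0.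
by rewrite divr_gt0// exprn_gt0// subr_gt0 Aw.
Qed.

(* -1 marks the failure of the block *)
(** The value -1 marks the failure of the block. It lies outside the range of
    the chi-squared sums, so this single random variable records both the
    success of the block and its sum. *)
Definition marked_chi2 A (w : Omega) : measurableTypeR R :=
  if w \in all_succeed A then chi2_block A w else (-1)%R.

Lemma measurable_marked_chi2 A :
  measurable_fun setT (marked_chi2 A : g_sigma_algebraType (cylinder X A) -> R).
Proof.
apply: measurable_fun_ifT => //; last exact: measurable_chi2_block.
apply: (measurable_fun_bool true); rewrite setTI.
rewrite (_ : _ @^-1` _ = all_succeed A); first exact: all_succeed_cylinder.
by apply/seteqP; split => w /=; [move=> /set_mem|move=> /mem_set].
Qed.

Lemma marked_chi2_cylinder A B : measurable B ->
  <<s cylinder X A >> (marked_chi2 A @^-1` B).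
Proof.
by move=> mB; have := @measurable_marked_chi2 A measurableT B mB; rewrite setTI.
Qed.

Lemma measurable_marked_chi2_RV A : measurable_fun setT (marked_chi2 A).
Proof.
by move=> _ B mB; rewrite setTI; exact: (g_cylinder_measurable (marked_chi2_cylinder mB)).
Qed.

HB.instance Definition _ A :=
  isMeasurableFun.Build _ _ _ _ (marked_chi2 A) (measurable_marked_chi2_RV A).

Lemma marked_chi2_law k p A B : block_law_for k p A -> measurable B ->
  B `<=` `]0%R, +oo[ ->
  P (marked_chi2 A @^-1` B) = k * \int[leb]_(u in B) (gamma_kernel p u)%:E.
Proof.
move=> law mB B0; rewrite -law//; congr (P _); apply/seteqP; split => w /=.
  rewrite /marked_chi2; case: ifPn => [/set_mem //|_] /B0/=.
  by rewrite in_itv/= andbT ltr0N1.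
by move=> [Aw Bw]; rewrite /marked_chi2 ifT//; exact/mem_set.
Qed.

(** The marked sums of disjoint blocks are independent, so their joint law is the
    product measure; restricted to the positive quadrant it has a product of
    gamma densities, and the law of the sum is their convolution. *)
Lemma block_law_step k k' p q A A' : [disjoint A & A']%B ->
  A != finset.set0 -> A' != finset.set0 ->
  0 <= k -> block_law_for k p A -> 0 <= k' -> block_law_for k' q A' ->
  exists2 k, 0 <= k & block_law_for k (p + q) (A :|: A')%SET.
Proof.
move=> AA' A0 A'0 k0 law k'0 law'.
have [r r0 kr] := block_law_finite k0 law.
exists (k * k' * \int[leb]_v (beta_kernel p q v)%:E).
  rewrite !mule_ge0//; apply: integral_ge0 => v _.
  by rewrite lee_fin beta_kernel_ge0.
move=> B mB.
pose V : {RV P >-> measurableTypeR R} := marked_chi2 A.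
pose V' : {RV P >-> measurableTypeR R} := marked_chi2 A'.
pose m1 := distribution P V; pose m2 := distribution P V'.
pose C : set (measurableTypeR R * measurableTypeR R) :=
  [set zu | (0 < zu.1)%R /\ (0 < zu.2)%R /\ B (zu.1 + zu.2)%R].
have mS : measurable_fun setT (fun zu : measurableTypeR R * measurableTypeR R =>
    (zu.1 + zu.2)%R : measurableTypeR R) by exact: measurable_funD.
have mC : measurable C.
  have mpos : measurable (`]0%R, +oo[%classic : set (measurableTypeR R)) by [].
  rewrite (_ : C = (fst @^-1` `]0%R, +oo[) `&`
      ((snd @^-1` `]0%R, +oo[) `&` ((fun zu => zu.1 + zu.2)%R @^-1` B))).
    apply: measurableI; first by rewrite -[X in measurable X]setTI; exact: measurable_fst.
    apply: measurableI; first by rewrite -[X in measurable X]setTI; exact: measurable_snd.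
    by rewrite -[X in measurable X]setTI; exact: (mS measurableT).
  by apply/seteqP; split => -[z u] /=; rewrite !in_itv/= !andbT.
have mCz z : measurable (xsection C z) by exact: measurable_xsection.
transitivity (P ((fun w => (V w, V' w)) @^-1` C)).
  congr (P _); apply/seteqP; split => w; rewrite /V /V' /C /= /marked_chi2.
    move=> [Uw Bw].
    have Aw : all_succeed A w by move=> i iA; apply: Uw; rewrite inE iA.
    have A'w : all_succeed A' w by move=> i iA; apply: Uw; rewrite inE iA orbT.
    rewrite !ifT; [|exact/mem_set..].
    split; first exact: chi2_block_gt0.
    split; first exact: chi2_block_gt0.
    move: Bw; rewrite /chi2_block /chi2_run.
    by rewrite (eq_bigl _ _ (fun i => finset.in_setU i A A')) bigU.
  case: ifPn => [/set_mem Aw|_ []]; last by rewrite ltr0N1.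
  case: ifPn => [/set_mem A'w|_ [_ []]]; last by rewrite ltr0N1.
  move=> [_ [_ Bw]]; split.
    by move=> i; rewrite inE => /orP[]; [exact: Aw|exact: A'w].
  move: Bw; rewrite /chi2_block /chi2_run.
  by rewrite (eq_bigl _ _ (fun i => finset.in_setU i A A')) bigU.
transitivity ((m1 \x m2) C).
  pose W w := (V w, V' w).
  have mW : measurable_fun setT W by exact: measurable_fun_pair.
  pose J0 : {measure set (measurableTypeR R * measurableTypeR R) -> \bar R} :=
    pushforward P W.
  pose J := J0 mW.
  rewrite (@product_measure_unique _ _ _ _ _ m1 m2 J)// => D D' mD mD'.
  exact: (g_cylinder_indep indepX AA' (marked_chi2_cylinder mD)
    (marked_chi2_cylinder mD')).
pose h z := m2 (xsection C z).
have h0 z : 0 <= h z by [].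
have mh : measurable_fun setT h by exact: measurable_fun_xsection.
transitivity (\int[m1]_(z in `]0%R, +oo[) h z).
  rewrite -[LHS]/(\int[m1]_z h z) [RHS]integral_mkcond.
  apply: eq_integral => z _; rewrite patchE; case: ifPn => // /negP.
  rewrite inE/= in_itv/= andbT => /negP; rewrite -leNgt => z0.
  rewrite /h (_ : xsection C z = set0); first exact: measure0.
  by apply/seteqP; split => // u /xsectionP[/=]; rewrite ltNge z0.
have mg := measurable_gamma_kernel (R := R).
have g0 := gamma_kernel_ge0 (R := R).
pose nu : {measure set (measurableTypeR R) -> \bar R} :=
  mscale (NngNum r0) (density leb (mg p) (g0 p)).
transitivity (\int[nu]_(z in `]0%R, +oo[) h z).
  apply: eq_measure_integral => D mD D0.
  by rewrite -[LHS]/(P (marked_chi2 A @^-1` D)) (marked_chi2_law law mD D0) kr.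
rewrite ge0_integral_mscale//; last exact: measurable_funTS.
rewrite [X in _ * X = _]integral_mkcond ge0_integral_density//; last 2 first.
- by apply/(measurable_restrictT _ _).1 => //; exact: measurable_funTS.
- by apply: erestrict_ge0.
rewrite /= -kr -!muleA; congr (k * _).
rewrite -gamma_kernel_convolution// -ge0_integralZl//; last 2 first.
- pose F (zu : measurableTypeR R * measurableTypeR R) :=
    (\1_B (zu.1 + zu.2) * (gamma_kernel p zu.1 * gamma_kernel q zu.2))%:E.
  apply: (@measurable_fun_fubini_tonelli_F _ _ _ _ _ leb F).
    apply/measurable_EFinP; apply: measurable_funM.
      by apply: (measurableT_comp _ mS); exact: measurable_indic.
    apply: measurable_funM; first exact: (measurableT_comp (mg p)).
    exact: (measurableT_comp (mg q)).
  by move=> zu; rewrite /F lee_fin !mulr_ge0.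
- by move=> z _; apply: integral_ge0 => u _; rewrite lee_fin !mulr_ge0.
apply: eq_integral => z _; rewrite patchE mem_setE/= in_itv/= andbT.
have [z0|z0] := ltP 0%R z; last first.
  rewrite mul0e integral0_eq ?mule0// => u _.
  by rewrite /gamma_kernel ltNge z0 mul0r mulr0.
rewrite -[h z]/(P (marked_chi2 A' @^-1` (xsection C z))) (marked_chi2_law law').
- rewrite -muleA; congr (k' * _).
  rewrite [in LHS]integral_mkcond -ge0_integralZr//; last 3 first.
  + apply/(measurable_restrictT _ _).1 => //; apply: measurable_funTS.
    by apply/measurable_EFinP; apply: mg.
  + by move=> u _; apply: erestrict_ge0 => v _; rewrite lee_fin.
  + by rewrite lee_fin.
  apply: eq_integral => u _; rewrite patchE.
  have [u0|u0] := ltP 0%R u; last first.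
    rewrite [gamma_kernel q u]/gamma_kernel ltNge u0 !mulr0.
    by case: ifP => _; rewrite mul0e.
  have -> : (u \in xsection C z) = ((z + u)%R \in B).
    apply/idP/idP => [/set_mem/xsectionP[_ [_ ?]]|/set_mem ?]; apply/mem_set => //.
    exact/xsectionP.
  rewrite indicE; case: ifP => _; last by rewrite mul0e mul0r.
  by rewrite mul1r mulrC EFinM.
- exact: mCz.
- by move=> u /xsectionP[/= _ [u0 _]]; rewrite in_itv/= u0.
Qed.

Lemma block_law A : A != finset.set0 ->
  exists2 k, 0 <= k & block_law_for k (#|A|%:R / 2) A.
Proof.
move En : #|A| => n; elim: n A En => [A /eqP|n IH A En A0].
  by rewrite cards_eq0 => ->.
have /set0Pn[i iA] := A0.
have [A1|A1] := eqVneq (A :\ i)%SET finset.set0.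
  have [k k0 law] := block_law1 i; exists k => //.
  have AE : A = [set i]%SET by rewrite -(finset.setD1K iA) A1 finset.setU0.
  suff -> : n = 0%N by rewrite AE mul1r.
  by move: En; rewrite AE cards1 => -[].
have [k k0 law] := block_law1 i.
have [|k' k'0 law'] := IH (A :\ i)%SET _ A1.
  by move: En; rewrite (cardsD1 i A) iA => -[].
have [||k2 k20 law2] := block_law_step _ _ A1 k0 law k'0 law'.
- by rewrite disjoints1 !inE eqxx.
- by apply/set0Pn; exists i; exact: set11.
exists k2 => //.
by rewrite -(finset.setD1K iA) -[n.+1]addn1 natrD mulrDl mul1r addrC.
Qed.

(** The unknown constant cancels: it is the ratio of the total mass 2^-#|A| to
    the integral of the gamma density over the positive half-line. *)
Lemma prob_block_lt A (t : R) : A != finset.set0 -> (0 < t)%R ->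
  P (all_succeed A `&` [set w | chi2_block A w < t]%R) =
  (2^-1 ^+ #|A| *
   (lower_gamma (#|A|%:R / 2) (t / 2) / Gamma (#|A|%:R / 2)))%:E.
Proof.
move=> A0 t0; have [k k0 law] := block_law A0.
have [r r0 kr] := block_law_finite k0 law.
pose p : R := (#|A|%:R / 2)%R.
pose f (s : measurableTypeR R) : R := (s `^ (p - 1) * expR (- s))%R.
have f0 s : (0 <= f s)%R by rewrite mulr_ge0 ?powR_ge0 ?expR_ge0.
have mf : measurable_fun setT (EFin \o f).
  apply/measurable_EFinP; apply: measurable_funM; first exact: measurable_powR.
  by apply: measurableT_comp => //; exact: measurableT_comp.
pose I D := \int[leb]_(s in D) (f s)%:E.
have total : (r * 2 `^ p)%:E * I `]0%R, +oo[%classic = (2^-1 ^+ #|A|)%:E.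
  have := law setT measurableT; rewrite preimage_setT setIT prob_all_succeed => ->.
  rewrite integral_gamma_kernel// kr EFinM -muleA.
  by congr (_ * (_ * integral _ _ _)); rewrite setTI.
have part : P (all_succeed A `&` [set w | chi2_block A w < t]%R) =
    (r * 2 `^ p)%:E * I `]0%R, (t / 2)%R]%classic.
  have -> : [set w | chi2_block A w < t]%R = chi2_block A @^-1` `]-oo, t[%classic.
    by apply/seteqP; split => w; rewrite /= in_itv.
  rewrite law// integral_gamma_kernel// kr EFinM -muleA; congr (_ * (_ * _)).
  rewrite [in RHS]/I -integral_itv_bndo_bndc; last exact: measurable_funTS.
  congr (integral _ _ _); apply/seteqP.
  split => s /=; rewrite !in_itv/= ?andbT ltr_pdivlMr// mulrC.
    by move=> [-> ->].
  by move=> /andP[-> ->].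
have c0 : (0 <= r * 2 `^ p)%R by rewrite mulr_ge0 ?powR_ge0.
have p0 : (2^-1 ^+ #|A| != 0 :> R)%R by rewrite expf_eq0 invr_eq0 pnatr_eq0 andbF.
have [G GE] : exists G : R, I `]0%R, +oo[%classic = G%:E.
  have : 0 <= I `]0%R, +oo[%classic by apply: integral_ge0 => s _; rewrite lee_fin.
  move: total; case: (I _) => [G _ _|+ _|//]; first by exists G.
  move: c0; rewrite le_eqVlt => /predU1P[<-|c0].
    by rewrite mul0e => -[] /esym/eqP; rewrite (negbTE p0).
  by rewrite gt0_muley// lte_fin.
have [L LE] : exists L : R, I `]0%R, (t / 2)%R]%classic = L%:E.
  have : 0 <= I `]0%R, (t / 2)%R]%classic by apply: integral_ge0 => s _; rewrite lee_fin.
  have : I `]0%R, (t / 2)%R]%classic <= I `]0%R, +oo[%classic.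
    apply: ge0_subset_integral => //.
    - exact: measurable_funTS.
    - by move=> s _; rewrite lee_fin.
    - by apply: subset_itvl.
  by rewrite GE; case: (I _) => [L _ _|//|//]; exists L.
rewrite part LE.
have -> : lower_gamma p (t / 2) = L.
  by rewrite /lower_gamma /Rintegral -[X in fine X]/(I _) LE.
have -> : Gamma p = G.
  by rewrite /Gamma /Rintegral -[X in fine X]/(I _) GE.
move: total; rewrite GE -!EFinM => -[] total; congr EFin.
rewrite -total; field.
by apply: contra_neq p0 => G0; rewrite -total G0 mulr0.
Qed.

End block_law.

(** * Success runs of a fixed set of successes *)

Section runs_of_set.
Variable N : nat.
Implicit Types S A B : {set 'I_N}.
Local Open Scope set_scope.

Definition block_in S A : bool :=
  [&& A != finset.set0, consecutive A & A \subset S].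

Definition runs S : {set {set 'I_N}} := finset (fun A => maxset (block_in S) A).

Lemma success_runE (R : realType) (x mu : 'I_N -> R) A :
  success_run x mu A = (A \in runs (finset (success x mu))).
Proof.
rewrite inE /success_run; congr (maxset _ _); apply/funext => B.
rewrite /success_block /block_in; do 2 congr andb; apply/forall_inP/fintype.subsetP.
  by move=> h i /h; rewrite inE.
by move=> h i /h; rewrite inE.
Qed.

Lemma consecutiveP A : reflect
  (forall i k j : 'I_N, i \in A -> k \in A -> (i <= j <= k)%N -> j \in A)
  (consecutive A).
Proof.
apply: (iffP forall_inP) => [h i k j iA kA ijk|h i iA].
  by have /forall_inP/(_ k kA)/forallP/(_ j)/implyP := h i iA; apply.
by apply/forall_inP => k kA; apply/forallP => j; apply/implyP; exact: h.
Qed.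

(** A gap between the two blocks is excluded by the common index [i]. *)
Lemma consecutiveU A B i : i \in A -> i \in B ->
  consecutive A -> consecutive B -> consecutive (A :|: B).
Proof.
move=> iA iB /consecutiveP cA /consecutiveP cB; apply/consecutiveP => j k l.
rewrite !finset.in_setU => jAB kAB /andP[jl lk].
have [li|il] := leqP l i.
  case/orP: jAB => [jA|jB]; first by rewrite (cA j i) ?jl.
  by rewrite (cB j i) ?jl ?orbT.
case/orP: kAB => [kA|kB]; first by rewrite (cA i k) ?(ltnW il).
by rewrite (cB i k) ?(ltnW il) ?orbT.
Qed.

Lemma run_block S A : A \in runs S -> block_in S A.
Proof. by rewrite inE => /maxsetP[]. Qed.

Lemma run_sub S A : A \in runs S -> A \subset S.
Proof. by move=> /run_block/and3P[]. Qed.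

Lemma run_neq0 S A : A \in runs S -> A != finset.set0.
Proof. by move=> /run_block/and3P[]. Qed.

(** The union of the two blocks is again a block, and a run is maximal. *)
Lemma run_absorb S A B i : A \in runs S -> block_in S B ->
  i \in A -> i \in B -> B \subset A.
Proof.
move=> rA /and3P[B0 cB sB] iA iB; have /and3P[A0 cA sA] := run_block rA.
move: rA; rewrite inE => /maxsetP[_ maxA].
rewrite -(maxA (A :|: B)) ?finset.subsetUl ?finset.subsetUr//.
rewrite /block_in (consecutiveU iA iB)// finset.subUset sA sB !andbT.
by apply/set0Pn; exists i; rewrite finset.in_setU iA.
Qed.

Lemma runs_disjoint S A B : A \in runs S -> B \in runs S -> A != B ->
  [disjoint A & B]%B.
Proof.
move=> rA rB; apply: contraNT; rewrite -setI_eq0 => /set0Pn[i].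
rewrite finset.in_setI => /andP[iA iB].
rewrite finset.eqEsubset (run_absorb rA (run_block rB) iA iB).
by rewrite (run_absorb rB (run_block rA) iB iA).
Qed.

Lemma mem_run S i : i \in S -> exists2 A, A \in runs S & i \in A.
Proof.
move=> iS; have bi : block_in S [set i].
  rewrite /block_in finset.sub1set iS andbT; apply/andP; split.
    by apply/set0Pn; exists i; exact: set11.
  apply/consecutiveP => j k l /set1P-> /set1P->.
  by rewrite -eqn_leq => /eqP/val_inj->; exact: set11.
have [A mA /fintype.subsetP sA] := maxset_exists bi.
by exists A; [rewrite inE|apply: sA; exact: set11].
Qed.

Lemma card_runs S : (\sum_(A in runs S) #|A| = #|S|)%N.
Proof.
have /eqP -> : finset.trivIset (runs S).
  by apply/finset.trivIsetP => A B; exact: runs_disjoint.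
congr #|pred_of_set _|; apply/finset.setP => i; apply/bigcupP/idP => [[A]|].
  by move=> /run_sub/fintype.subsetP; exact.
by move/mem_run => [A]; exists A.
Qed.
End runs_of_set.

(** * Probability of a pattern of successes with a small statistic *)

Section pattern_probability.
Context (R : realType) (d : measure_display) (Omega : measurableType d).
Context (P : probability Omega R) (N : nat) (mu sigma : 'I_N -> R).
Hypothesis sigma_gt0 : forall i, 0 < sigma i.
Variable X : 'I_N -> {RV P >-> R}.
Hypothesis indepX : mutually_independent X.
Hypothesis normalX : forall i, normally_distributed (X i) (mu i) (sigma i).
Variable t : R.
Hypothesis t_gt0 : 0 < t.
Implicit Types S A : {set 'I_N}.

Definition success_set (w : Omega) : {set 'I_N} :=
  finset (success (fun i => X i w) mu).

Definition chi2_cdf (l : nat) : R :=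
  lower_gamma (l%:R / 2) (t / 2) / Gamma (l%:R / 2).

Definition pattern_event S : set Omega :=
  [set w | success_set w = S /\ run_stat (fun i => X i w) mu sigma < t].

Definition all_fail A : set Omega := [set w | forall i, i \in A -> X i w <= mu i].

Definition run_event A : set Omega :=
  all_succeed mu X A `&` [set w | chi2_block mu sigma X A w < t].

Lemma all_fail_cylinder A : <<s cylinder X A >> (all_fail A).
Proof.
apply: sub_sigma_algebra; exists (fun i => [set x | x <= mu i]) => [i|].
  by rewrite -set_itvNyc.
by [].
Qed.

Lemma run_event_cylinder A : <<s cylinder X A >> (run_event A).
Proof.
apply: (@measurableI _ (g_sigma_algebraType (cylinder X A))).
  exact: all_succeed_cylinder.
have -> : [set w | chi2_block mu sigma X A w < t] =
    chi2_block mu sigma X A @^-1` `]-oo, t[.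
  by apply/seteqP; split => w; rewrite /= in_itv.
exact: chi2_block_cylinder.
Qed.

Lemma prob_all_fail A : P (all_fail A) = (2^-1 ^+ #|A|)%:E.
Proof.
rewrite -[LHS]/(P (\bigcap_(i in [set` A]) (X i @^-1` [set x | x <= mu i]))).
rewrite indepX; last by move=> i; rewrite -set_itvNyc.
rewrite (eq_bigr (fun=> 2^-1%:E)); first by rewrite prodEFin prodr_const.
move=> i _; rewrite (_ : X i @^-1` _ = ~` (X i @^-1` [set x | mu i < x])).
  rewrite probability_setC; last first.
    by apply: measurable_preimage_RV; rewrite -set_itvoy.
  rewrite (prob_success sigma_gt0 normalX) -EFinB; congr EFin.
  by field.
by apply/seteqP; split => w /=; [move=> h; apply/negP; rewrite -leNgt|move=> /negP; rewrite -leNgt].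
Qed.

Lemma run_stat_lt w :
  (run_stat (fun i => X i w) mu sigma < t) =
  [forall A in runs (success_set w), chi2_block mu sigma X A w < t].
Proof.
apply/bigmax_ltP/forall_inP => [[_ h] A rA|h].
  by apply: h; rewrite success_runE.
by split=> // A; rewrite success_runE => /h.
Qed.

(** Every success belongs to some run, so that success on all the runs and
    failure off [S] together force the set of successes to be [S]. *)
Lemma pattern_eventE S :
  pattern_event S = all_fail (~: S)%SET `&` \bigcap_(A in [set` runs S]) run_event A.
Proof.
apply/seteqP; split => w /=.
  rewrite /pattern_event/= run_stat_lt => -[<- /forall_inP h]; split => [i|A /= rA].
    by rewrite !inE /success -leNgt.
  split; last exact: h.
  by move=> i iA; have /fintype.subsetP/(_ i iA) := run_sub rA; rewrite inE.
move=> [fw rw]; have SE : success_set w = S.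
  apply/finset.setP => i; rewrite inE /success; apply/idP/idP.
    by apply: contraTT => iS; rewrite -leNgt; apply: fw; rewrite inE.
  by move=> /mem_run[A rA iA]; have [Aw _] := rw A rA; exact: Aw.
split => //; rewrite run_stat_lt SE; apply/forall_inP => A rA.
by have [] := rw A rA.
Qed.

Lemma measurable_pattern_event S : measurable (pattern_event S).
Proof.
rewrite pattern_eventE; apply: measurableI.
  exact: (g_cylinder_measurable (all_fail_cylinder (A:=_))).
apply: fin_bigcap_measurable => // A _.
exact: (g_cylinder_measurable (run_event_cylinder (A:=_))).
Qed.

(** The complement of [S] and the runs of [S] are pairwise disjoint blocks. *)
Lemma prob_pattern_event S :
  P (pattern_event S) = (2^-1 ^+ N * \prod_(A in runs S) chi2_cdf #|A|)%:E.
Proof.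
pose F A := if A == (~: S)%SET then all_fail A else run_event A.
have runF A : A \in runs S -> A != (~: S)%SET.
  move=> rA; apply: contra_neqN (run_neq0 rA) => /eqP AE.
  apply/eqP; rewrite -(finset.setIid A) {1}AE.
  by rewrite setI_eq0 disjoint_sym finset.disjoints_subset finset.setCK run_sub.
have disj A : A \in runs S -> [disjoint A & (~: S)%SET]%B.
  by move=> rA; rewrite finset.disjoints_subset finset.setCK run_sub.
have -> : pattern_event S = \bigcap_(A in [set` (~: S)%SET :: enum (runs S)]) F A.
  rewrite pattern_eventE; apply/seteqP; split => w /=.
    move=> [fw rw] A /=; rewrite inE mem_enum => /predU1P[->|rA]; rewrite /F ?eqxx//.
    by rewrite (negbTE (runF A rA)); exact: rw.
  move=> h; split.
    by have := h (~: S)%SET; rewrite /= mem_head /F eqxx; apply.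
  move=> A /= rA; have := h A; rewrite /= inE mem_enum rA orbT /F.
  by rewrite (negbTE (runF A rA)); apply.
rewrite (g_cylinder_indep_bigcap indepX (A := id)).
- rewrite big_cons big_enum/= {1}/F eqxx prob_all_fail.
  rewrite (eq_bigr (fun A => (2^-1 ^+ #|A| * chi2_cdf #|A|)%:E)); last first.
    move=> A rA; rewrite /F (negbTE (runF A rA)).
    by rewrite /run_event (prob_block_lt sigma_gt0 indepX normalX (run_neq0 rA) t_gt0).
  rewrite prodEFin -EFinM; congr EFin; rewrite big_split/= mulrA; congr (_ * _).
  rewrite prodrXr card_runs -exprD; congr (_ ^+ _).
  by rewrite addnC cardsC card_ord.
- rewrite /= enum_uniq andbT mem_enum; apply/negP => /runF.
  by rewrite eqxx.
- move=> A B; rewrite !inE !mem_enum => /predU1P[->|rA] /predU1P[->|rB] AB.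
  + by rewrite eqxx in AB.
  + by rewrite disjoint_sym; exact: disj.
  + exact: disj.
  + exact: runs_disjoint rA rB AB.
- move=> A _; rewrite /F; case: ifP => _; first exact: all_fail_cylinder.
  exact: run_event_cylinder.
Qed.

Lemma cond_prob_runs :
  cond_prob P
    [set w | run_stat (fun i => X i w) mu sigma < t]
    [set w | exists i, success (fun j => X j w) mu i] =
  (\sum_(S : {set 'I_N} | S != finset.set0) \prod_(A in runs S) chi2_cdf #|A|)
    / (2 ^+ N - 1).
Proof.
rewrite /cond_prob.
have -> : P [set w | exists i, success (fun j => X j w) mu i] =
    (1 - 2^-1 ^+ N)%:E.
  have -> : [set w | exists i, success (fun j => X j w) mu i] = ~` all_fail [set: 'I_N]%SET.
    apply/seteqP; split => w /=.
      by move=> [i]; rewrite /success => h /(_ i); rewrite finset.in_setT leNgt h => /(_ isT).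
    move=> h; apply: contrapT => h'; apply: h => i _; rewrite leNgt; apply/negP => iw.
    by apply: h'; exists i.
  rewrite probability_setC ?prob_all_fail ?cardsT ?card_ord//.
  exact: (g_cylinder_measurable (all_fail_cylinder (A:=_))).
have -> : [set w | run_stat (fun i => X i w) mu sigma < t] `&`
    [set w | exists i, success (fun j => X j w) mu i] =
    \bigcup_(S in [set` enum [pred S : {set 'I_N} | S != finset.set0]]) pattern_event S.
  apply/seteqP; split => w /=.
    move=> [Tw [i iw]]; exists (success_set w) => //=.
    by rewrite mem_enum inE; apply/set0Pn; exists i; rewrite inE.
  move=> [S /=]; rewrite mem_enum inE => /set0Pn[i iS] [SE Tw]; split => //.
  by exists i; move: iS; rewrite -SE inE.
rewrite measure_fin_bigcup//; last 2 first.
- move=> S S' _ _ [w [[<- _] [<- _]]]; by [].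
- by move=> S _; exact: measurable_pattern_event.
rewrite -fsbig_seq ?enum_uniq// big_enum/=.
rewrite (eq_bigr _ (fun S _ => prob_pattern_event S)) sumEFin/= -mulr_sumr.
set s := \sum_(S | _) _.
have N0 : (2 : R) ^+ N != 0 by rewrite expf_neq0 ?pnatr_eq0.
rewrite exprVn -[1 - _](_ : (2 ^+ N - 1) / 2 ^+ N = _); last by rewrite mulrBl divff// mul1r.
by rewrite invfM invrK [LHS]mulrC -!mulrA mulVKf // mulrC.
Qed.
End pattern_probability.

(** * Run lengths as gaps between failures *)

Section gaps.
Local Open Scope nat_scope.
Implicit Types (s : seq bool) (g : seq nat).

(** The numbers of successes before the first failure, between consecutive
    failures, and after the last one. Empty gaps are kept: this makes the
    encoding a bijection onto nonempty sequences. *)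
Fixpoint gaps s : seq nat :=
  if s is x :: s' then
    if x then (head 0 (gaps s')).+1 :: behead (gaps s') else 0 :: gaps s'
  else [:: 0].

(** Each gap is preceded by a failure, so the decoded sequence starts with one
    spurious failure. *)
Definition separated_runs g : seq bool :=
  flatten [seq false :: nseq l true | l <- g].

Lemma separated_runs_gaps s : separated_runs (gaps s) = false :: s.
Proof.
elim: s => [//|[] s IH] /=; last by rewrite /separated_runs/= -IH.
by case: (gaps s) IH => [//|l g]; rewrite /separated_runs/= => -[->].
Qed.

Lemma gaps_cat_nseq l s :
  gaps (nseq l true ++ s) = (l + head 0 (gaps s)) :: behead (gaps s).
Proof. by elim: l => [|l /= -> //]; case: s => [|[]]. Qed.

Lemma gaps_separated_runs g : gaps (separated_runs g) = 0 :: g.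
Proof.
elim: g => [//|l g IH].
by rewrite -[separated_runs _]/(false :: nseq l true ++ separated_runs g)/=
  gaps_cat_nseq IH/= addn0.
Qed.

Lemma sumn_gaps s : sumn (gaps s) = count id s.
Proof.
elim: s => [//|[] s /= <-]; rewrite ?add0n//.
by case: (gaps s).
Qed.

Lemma size_gaps s : size (gaps s) = (count negb s).+1.
Proof.
elim: s => [//|[] s /= IH]; last by rewrite IH.
by rewrite size_behead IH.
Qed.

Lemma head_gaps s : head 0 (gaps s) = find negb s.
Proof. by elim: s => [//|[] s /= IH //]; rewrite IH. Qed.

End gaps.

Section starts.
Variables (R : comPzSemiRingType) (F : nat -> R).
Implicit Types s : seq bool.

(** The product over the positions where a run starts of [F] at the length of
    that run, [b] being the outcome that precedes [s]. *)
Definition starts_prod (b : bool) s : R :=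
  \prod_(0 <= a < size s | ~~ nth false (b :: s) a && nth false s a)
     F (find negb (drop a s)).

Lemma starts_prod_cons b x s : starts_prod b (x :: s) =
  (if ~~ b && x then F (find negb (x :: s)) else 1) * starts_prod x s.
Proof.
rewrite /starts_prod /= big_mkcond big_nat_recl//=; congr (_ * _).
by rewrite -big_mkcond.
Qed.

(** A success that precedes [s] absorbs the first gap, so the induction handles
    both possible values of the preceding outcome. *)
Lemma starts_prod_gaps s : starts_prod false s = \prod_(l <- gaps s | (0 < l)%N) F l.
Proof.
suff : starts_prod false s = \prod_(l <- gaps s | (0 < l)%N) F l /\
       starts_prod true s = \prod_(l <- behead (gaps s) | (0 < l)%N) F l by case.
elim: s => [|[] s [IH1 IH2]] /=.
- by rewrite /starts_prod/= !big_nil big_cons/= big_nil.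
- rewrite !starts_prod_cons/= mul1r IH2; split=> //.
  by rewrite big_cons/= head_gaps.
- by rewrite !starts_prod_cons/= !mul1r IH1 big_cons.
Qed.
End starts.

Section runs_bits.
Variable N : nat.
Implicit Types (S A : {set 'I_N}) (a : nat).
Local Open Scope nat_scope.

Definition bits S : seq bool := [seq i \in S | i <- enum 'I_N].

Lemma size_bits S : size (bits S) = N.
Proof. by rewrite size_map size_enum_ord. Qed.

Lemma nth_bits S (i : 'I_N) : nth false (bits S) i = (i \in S).
Proof. by rewrite (nth_map i) ?size_enum_ord// nth_ord_enum. Qed.

Lemma count_bits S : count id (bits S) = #|S|.
Proof.
rewrite count_map -sum1_count big_enum_cond -sum1_card.
by apply: eq_bigl => i.
Qed.

Lemma card_interval (a b : nat) : b <= N ->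
  #|[set i : 'I_N | a <= i < b]%SET| = b - a.
Proof.
move=> bN; rewrite -sum1_card.
rewrite (eq_bigl (fun i : 'I_N => (a <= i) && (i < b))); last by move=> i; rewrite inE.
rewrite -(big_ord_widen_cond _ (fun i => a <= i) (fun=> 1)) //.
by rewrite -(big_geq_mkord a b xpredT (fun=> 1)) sum_nat_const_nat muln1.
Qed.

Let lead S (a : nat) := find negb (drop a (bits S)).
Let start S (a : nat) := ~~ nth false (false :: bits S) a && nth false (bits S) a.
Let run_from S (a : nat) : {set 'I_N} := [set i : 'I_N | a <= i < a + lead S a]%SET.

Lemma lead_le S (a : 'I_N) : a + lead S a <= N.
Proof.
have := find_size negb (drop a (bits S)); rewrite size_drop size_bits => h.
by rewrite -leq_subRL// ltnW.
Qed.

Lemma before_lead S a i : a <= i < a + lead S a -> nth false (bits S) i.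
Proof.
move=> /andP[ai il].
have /(before_find false) : i - a < lead S a by rewrite ltn_subLR.
by rewrite nth_drop subnKC// => /negbFE.
Qed.

Lemma at_lead S a : ~~ nth false (bits S) (a + lead S a).
Proof.
have [h|h] := ltnP (lead S a) (size (drop a (bits S))).
  by rewrite -nth_drop; apply: (@nth_find _ false negb); rewrite has_find.
rewrite nth_default// size_bits; move: h; rewrite size_drop size_bits.
by rewrite leq_subLR.
Qed.

Lemma run_from_start S (a : 'I_N) : start S a -> a \in run_from S a.
Proof.
move=> /andP[_ cur]; rewrite inE leqnn -[X in X < _]addn0 ltn_add2l lt0n.
by apply: contraTneq cur => h; have := at_lead S a; rewrite h addn0.
Qed.

(** The interval starting at [a] is bounded on the left by a failure or by the
    first index, and on the right by a failure or by the last index; a larger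
    block would contain one of these failures. *)
Lemma run_from_run S (a : 'I_N) : start S a -> run_from S a \in runs S.
Proof.
move=> sa; have aR := run_from_start sa; case/andP: sa => prev _.
have bR : block_in S (run_from S a).
  apply/and3P; split.
  - by apply/set0Pn; exists a.
  - apply/consecutiveP => i k j; rewrite !inE => /andP[ai _] /andP[_ kl] /andP[ij jk].
    by rewrite (leq_trans ai ij) (leq_ltn_trans jk kl).
  - by apply/fintype.subsetP => i; rewrite inE => /before_lead; rewrite nth_bits.
rewrite inE; apply/maxsetP; split=> // B.
move=> /and3P[_ /consecutiveP cB /fintype.subsetP sB] /fintype.subsetP RB.
have aB := RB a aR.
apply/eqP; rewrite finset.eqEsubset; apply/andP; split; last exact/fintype.subsetP.
apply/fintype.subsetP => i iB; rewrite inE; apply/andP; split.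
  rewrite leqNgt; apply/negP => ia.
  have a0 : 0 < a by exact: leq_ltn_trans ia.
  have a1N : a.-1 < N by rewrite (leq_ltn_trans (leq_pred _)).
  have /sB : Ordinal a1N \in B.
    by apply: (cB i a) => //=; rewrite leq_pred andbT -ltnS prednK.
  have aE : nth false (false :: bits S) a = nth false (bits S) (Ordinal a1N).
    by rewrite /=; case: (val a) a0.
  by move: prev; rewrite aE nth_bits => /negbTE ->.
rewrite ltnNge; apply/negP => li.
have jN : a + lead S a < N by exact: leq_ltn_trans li _.
have /sB : Ordinal jN \in B by apply: (cB a i) => //=; rewrite leq_addr.
by rewrite -nth_bits/= (negbTE (at_lead S a)).
Qed.

(** The start is the least [b] such that all indices from [b] to [i] are in
    [S]. *)
Lemma mem_run_from S i : i \in S -> exists2 a : 'I_N, start S a & i \in run_from S a.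
Proof.
move=> iS.
pose Q b := (b <= i) && [forall j : 'I_N, (b <= j <= i) ==> (j \in S)].
have exQ : exists b, Q b.
  exists i; rewrite /Q leqnn; apply/forallP => j; apply/implyP.
  by rewrite -eqn_leq => /eqP/val_inj <-.
case: (ex_minnP exQ) => b /andP[bi /forallP bS] bmin.
have bN : b < N by exact: leq_ltn_trans bi _.
have bSj (j : 'I_N) : b <= j <= i -> j \in S by exact/implyP.
exists (Ordinal bN).
  apply/andP; split; last by rewrite nth_bits bSj//= leqnn.
  case: b => [//|c] in bi bS bmin bN bSj *; apply/negP => /= cS.
  have cN : c < N by exact: ltnW.
  have : Q c.
    rewrite /Q (ltnW bi); apply/forallP => j; apply/implyP => /andP[cj ji].
    have [jc|cj'] := leqP j c; last by rewrite bSj// cj'.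
    suff -> : j = Ordinal cN by rewrite -nth_bits.
    by apply: val_inj => /=; apply/eqP; rewrite eqn_leq jc.
  by move/bmin; rewrite ltnn.
rewrite inE /= bi ltnNge; apply/negP => li.
have jN : b + lead S b < N by exact: leq_ltn_trans li _.
have := at_lead S b; rewrite -[b + _]/(val (Ordinal jN)) nth_bits.
by rewrite bSj//= leq_addr.
Qed.

Lemma runs_starts S : runs S = [set run_from S (val a) | a in [set a : 'I_N | start S a]%SET]%SET.
Proof.
apply/finset.setP => A; apply/idP/imsetP => [rA|[a]]; last first.
  by rewrite inE => sa ->; exact: run_from_run.
have /set0Pn[i iA] := run_neq0 rA.
have /fintype.subsetP/(_ i iA)/mem_run_from[a sa ia] := run_sub rA.
exists a; first by rewrite inE.
apply: contraTeq iA => /(runs_disjoint rA (run_from_run sa)) dis.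
by rewrite (disjointFl dis ia).
Qed.

(** Runs correspond to their starting points, and these to the nonempty gaps. *)
Lemma prod_runs (R : comPzSemiRingType) (F : nat -> R) S :
  (\prod_(A in runs S) F #|A| = \prod_(l <- gaps (bits S) | (0 < l)%N) F l)%R.
Proof.
rewrite -starts_prod_gaps /starts_prod size_bits big_mkord runs_starts big_imset/=.
  rewrite (eq_bigl (fun a : 'I_N => start S a)); last by move=> a; rewrite inE.
  by apply: eq_bigr => a _; rewrite card_interval ?lead_le// addKn.
move=> a b; rewrite !inE => sa sb ab; apply/val_inj/eqP => /=.
have := run_from_start sa; rewrite ab inE => /andP[ba _].
have := run_from_start sb; rewrite -ab inE => /andP[ab' _].
by rewrite eqn_leq ab' ba.
Qed.
End runs_bits.

(** * Counting patterns with prescribed run lengths *)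

Section multiset_permutations.
Local Open Scope nat_scope.
Variable T : eqType.
Implicit Types s D : seq T.

Lemma sum_count_mem_undup s : \sum_(x <- undup s) count_mem x s = size s.
Proof.
rewrite -[RHS](perm_size (perm_count_undup s)) size_flatten sumnE /shape -map_comp big_map.
by apply: eq_bigr => x _; rewrite /= size_nseq.
Qed.

Lemma prod_fact_count_mem_rem D s x : uniq D -> x \in D -> x \in s ->
  \prod_(y <- D) (count_mem y s)`! =
  count_mem x s * \prod_(y <- D) (count_mem y (rem x s))`!.
Proof.
move=> uD xD xs; rewrite !(bigD1_seq x xD uD)/= mulnA count_mem_rem eqxx subn1.
congr (_ * _); last first.
  by apply: eq_bigr => y yx; rewrite count_mem_rem eq_sym (negbTE yx) subn0.
have : 0 < count_mem x s by rewrite -has_count has_pred1.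
by case: (count_mem x s).
Qed.

(** By induction on the first entry x: its removal divides the product of the
    factorials by the multiplicity of x, and the multiplicities sum to the
    length. The product runs over a fixed list [D] rather than over the entries
    of [s], so that it does not change its range in the induction. *)
Lemma size_permutations_multinomial D s : uniq D -> {subset s <= D} ->
  size (permutations s) * \prod_(x <- D) (count_mem x s)`! = (size s)`!.
Proof.
move=> uD; move En : (size s) => n; elim: n s En => [|n IH] s En sD.
  by rewrite (size0nil En) big1// mul1n.
rewrite (perm_size (permutationsE _)) ?En// size_allpairs_dep sumnE big_map.
rewrite big_distrl /= (eq_big_seq (fun x => count_mem x s * n`!)).
  by rewrite -big_distrl/= sum_count_mem_undup En.
move=> x /=; rewrite mem_undup => xs.
rewrite (prod_fact_count_mem_rem uD (sD x xs) xs) mulnCA IH//.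
- by rewrite size_rem// En.
- by move=> y /mem_rem; exact: sD.
Qed.
End multiset_permutations.

Section run_lengths.
Variable N : nat.
Implicit Types (S : {set 'I_N}) (q : seq nat).
Local Open Scope nat_scope.

Definition run_lengths S : seq nat := [seq l <- gaps (bits S) | 0 < l].

Lemma sumn_pos q : sumn [seq l <- q | 0 < l] = sumn q.
Proof. by elim: q => [//|[|l] q IH] //=; rewrite IH. Qed.

Lemma sumn_run_lengths S : sumn (run_lengths S) = #|S|.
Proof. by rewrite sumn_pos sumn_gaps count_bits. Qed.

Lemma size_gaps_bits S : size (gaps (bits S)) + #|S| = N.+1.
Proof.
by rewrite size_gaps -count_bits addSn addnC count_predC size_bits.
Qed.

Lemma size_run_lengths S : size (run_lengths S) <= (N - #|S|).+1.
Proof.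
rewrite size_filter (leq_trans (count_size _ _))// -subSn.
  by rewrite -(size_gaps_bits S) addnK.
by rewrite -[X in _ <= X](card_ord N) max_card.
Qed.

Lemma gaps_bits_inj : injective (fun S => gaps (bits S)).
Proof.
move=> S S' /(congr1 separated_runs); rewrite !separated_runs_gaps => -[E].
by apply/finset.setP => i; rewrite -!nth_bits E.
Qed.

Lemma gaps_bits_surj (g : seq nat) : size g + sumn g = N.+1 ->
  exists S, gaps (bits S) = g.
Proof.
case: g => [|l g] sg; first by [].
pose s := behead (separated_runs (l :: g)).
have gs : gaps s = l :: g.
  by have := gaps_separated_runs (l :: g); rewrite /s /separated_runs/= => -[].
have ss : size s = N.
  apply/eqP; rewrite -eqSS -sg -gs size_gaps sumn_gaps addSn eqSS.
  by rewrite addnC count_predC.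
exists [set i : 'I_N | nth false s i]%SET; rewrite -gs; congr gaps.
apply: (@eq_from_nth _ false); first by rewrite size_bits ss.
by move=> i; rewrite size_bits => iN; rewrite -[i]/(val (Ordinal iN)) nth_bits inE.
Qed.

(** Among sequences of a fixed length, the positive entries determine the number
    of zeros. *)
Lemma pos_perm_zeros g q : all (fun l => 0 < l) q -> size q <= size g ->
  perm_eq [seq l <- g | 0 < l] q = perm_eq g (q ++ nseq (size g - size q) 0).
Proof.
move=> /all_filterP qpos qg; apply/idP/idP => [gq|].
  have/permPl <- : perm_eq ([seq l <- g | 0 < l] ++ [seq l <- g | ~~ (0 < l)]) g.
    by rewrite perm_filterC.
  apply: perm_cat => //.
  have -> : size g - size q = count (fun l => ~~ (0 < l)) g.
    by rewrite -(perm_size gq) size_filter -(count_predC (fun l => 0 < l) g) addKn.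
  by elim: g {gq qg} => [//|[|l] g IH] //=; rewrite perm_cons.
move=> /(perm_filter (fun l => 0 < l)); rewrite filter_cat qpos.
by rewrite [X in q ++ X](_ : _ = [::]) ?cats0//; elim: (_ - _).
Qed.

Lemma leq_sumn_mem q l : l \in q -> l <= sumn q.
Proof.
elim: q => [//|m q IH] /=; rewrite inE => /predU1P[->|/IH lq].
  exact: leq_addr.
exact: leq_trans lq (leq_addl _ _).
Qed.

(** The gap encoding maps these sets onto the rearrangements of [q] padded with
    zeros; the factorial on the left accounts for the zeros. *)
Lemma card_run_lengths q : all (fun l => 0 < l) q -> sumn q <= N ->
  size q <= (N - sumn q).+1 ->
  #|[pred S | perm_eq (run_lengths S) q]| * ((N - sumn q).+1 - size q)`! *
    \prod_(1 <= l < N.+1) (count_mem l q)`! = (N - sumn q).+1`!.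
Proof.
move=> qpos qN qs; set k := _ - size q.
pose q0 := q ++ nseq k 0.
have sq0 : size q0 = (N - sumn q).+1 by rewrite size_cat size_nseq subnKC.
have sumq0 : sumn q0 = sumn q by rewrite sumn_cat sumn_nseq mul0n addn0.
have -> : #|[pred S | perm_eq (run_lengths S) q]| = size (permutations q0).
  rewrite cardE -(size_map (fun S => gaps (bits S))); apply: perm_size.
  apply: uniq_perm; [|exact: permutations_uniq|move=> g].
    by rewrite map_inj_uniq ?enum_uniq//; exact: gaps_bits_inj.
  rewrite mem_permutations; apply/mapP/idP => [[S]|gq].
    rewrite mem_enum inE => Sq ->.
    have cS : #|S| = sumn q by rewrite -sumn_run_lengths; exact: perm_sumn.
    have sg : size (gaps (bits S)) = (N - sumn q).+1.
      by rewrite -subSn// -(size_gaps_bits S) cS addnK.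
    by rewrite /q0 /k -sg -pos_perm_zeros// sg.
  have [|S gS] := @gaps_bits_surj g.
    rewrite (perm_size gq) (perm_sumn gq) sq0 sumq0 addSn subnK//.
  exists S => //; rewrite mem_enum inE /run_lengths gS pos_perm_zeros//.
    by rewrite (perm_size gq) sq0.
  by rewrite (perm_size gq) sq0.
rewrite -sq0 -(@size_permutations_multinomial _ (iota 0 N.+1) q0 (iota_uniq _ _)).
  rewrite -mulnA; congr (_ * _).
  rewrite -[iota 0 N.+1]/(0 :: iota 1 N) big_cons; congr (_ * _).
    rewrite count_cat count_nseq mul1n (count_memPn _) ?add0n//.
    by apply/negP => /(allP qpos).
  rewrite /index_iota subn1/=; apply: eq_big_seq => l.
  rewrite mem_iota => /andP[l0 _]; congr (_ `!).
  by rewrite count_cat count_nseq/= (ltn_eqF l0) addn0.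
move=> l; rewrite mem_cat mem_nseq mem_iota add0n/= ltnS => /orP[/leq_sumn_mem lq|].
  exact: leq_trans qN.
by move=> /andP[_ /eqP ->].
Qed.
End run_lengths.

(** * Summation over partitions *)

Section sum_over_partitions.
Variables (R : realType) (F : nat -> R) (N : nat).
Implicit Types (S : {set 'I_N}) (q : seq nat).

Lemma prod_expr_count_mem (D q : seq nat) : uniq D -> {subset q <= D} ->
  \prod_(l <- D) F l ^+ count_mem l q = \prod_(l <- q) F l.
Proof.
move=> uD; elim: q => [_|m q IH qD].
  by rewrite big_nil big1.
have mD : m \in D by apply: qD; rewrite mem_head.
rewrite big_cons -IH => [|l lq]; last by apply: qD; rewrite inE lq orbT.
rewrite !(bigD1_seq m mD uD)/= eqxx exprS -mulrA; congr (_ * (_ * _)).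
by apply: eq_bigr => l lm; rewrite eq_sym (negbTE lm).
Qed.

Lemma pochhammer_card q (r M : nat) : all (fun l => 0 < l)%N q -> sumn q = r ->
  size q = M -> (r <= N)%N -> (M <= N - r + 1)%N ->
  pochhammer (N - r + 2 - M) M / \prod_(1 <= l < N.+1) ((part_mult q l)`!)%:R =
  #|[pred S : {set 'I_N} | perm_eq (run_lengths S) q]|%:R :> R.
Proof.
move=> qpos qr qM rN; rewrite addn1 => MN.
have := @card_run_lengths N q qpos; rewrite qr qM => /(_ rN MN) h.
rewrite /pochhammer subnK; last by rewrite addn2 (leq_trans MN).
rewrite addn2/= subSn// -h !natrM natr_prod /part_mult.
have fact0 n : (n`!%:R != 0 :> R) by rewrite pnatr_eq0 -lt0n fact_gt0.
rewrite [LHS]mulrAC mulfK; last by rewrite prodf_seq_neq0; apply/allP => l _ /=.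
by rewrite mulfK.
Qed.

Definition run_product S : R := \prod_(l <- run_lengths S) F l.

Lemma run_productE S : \prod_(A in runs S) F #|A| = run_product S.
Proof. by rewrite prod_runs /run_product big_filter. Qed.

Lemma partition_term q (r M : nat) : all (fun l => 0 < l)%N q -> sumn q = r ->
  size q = M -> (r <= N)%N -> (M <= N - r + 1)%N ->
  (\prod_(1 <= l < N.+1) F l ^+ part_mult q l) *
  (pochhammer (N - r + 2 - M) M / \prod_(1 <= l < N.+1) ((part_mult q l)`!)%:R) =
  \sum_(S | perm_eq (run_lengths S) q) run_product S.
Proof.
move=> qpos qr qM rN MN; rewrite pochhammer_card//.
rewrite [RHS](eq_bigr (fun=> \prod_(l <- q) F l)); last first.
  by move=> S Sq; rewrite /run_product (perm_big _ Sq).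
rewrite sumr_const -[RHS]mulr_natr; congr (_ * _%:R).
rewrite prod_expr_count_mem ?iota_uniq// => l lq.
rewrite mem_index_iota (allP qpos)//= ltnS (leq_trans _ rN)// -qr.
exact: leq_sumn_mem.
Qed.

Lemma run_lengths_pos S : all (fun l => 0 < l)%N (run_lengths S).
Proof. exact: filter_all. Qed.

Lemma geq_trans : transitive geq.
Proof. by move=> b a c ab bc; exact: leq_trans bc ab. Qed.

Lemma geq_anti : antisymmetric geq.
Proof. by move=> a b /andP[ab ba]; apply/anti_leq/andP; split. Qed.

(** The only partition that contributes is the sorted list of run lengths of
    [S]. *)
Lemma sum_one_partition S (r M : nat) (h : R) :
  \sum_(p : M.-tuple 'I_r.+1 | is_intpart r [seq val l | l <- p])
     (if perm_eq (run_lengths S) [seq val l | l <- p] then h else 0) =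
  if (r == #|S|) && (M == size (run_lengths S)) then h else 0.
Proof.
set rl := run_lengths S.
case: ifPn => [/andP[/eqP rE /eqP ME]|rM]; last first.
  apply: big1 => p /and3P[_ _ /eqP pr]; case: ifPn => // rlp.
  case/negP: rM; rewrite -(sumn_run_lengths S) -/rl (perm_sumn rlp) pr eqxx/=.
  by rewrite (perm_size rlp) size_map size_tuple.
pose s := sort geq rl.
have rls : perm_eq rl s by rewrite perm_sym perm_sort.
have ssize : size s = M by rewrite size_sort -ME.
have ssum : sumn s = r by rewrite -(perm_sumn rls) sumn_run_lengths.
pose p0 : M.-tuple 'I_r.+1 := [tuple inord (nth 0%N s i) | i < M].
have p0E : [seq val l | l <- p0] = s.
  apply: (@eq_from_nth _ 0%N); first by rewrite size_map size_tuple.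
  move=> i; rewrite size_map size_tuple => iM.
  rewrite (nth_map ord0) ?size_tuple//.
  rewrite -[i]/(val (Ordinal iM)) -tnth_nth tnth_mktuple /= inordK//.
  by rewrite ltnS -ssum leq_sumn_mem// mem_nth// ssize.
rewrite (bigD1 p0)/=; last first.
  rewrite p0E /is_intpart ssum eqxx andbT; apply/andP; split.
    by apply: sort_sorted => a b; exact: leq_total.
  by rewrite -(perm_all _ rls) run_lengths_pos.
rewrite p0E rls big1 ?addr0// => p /andP[/and3P[psort _ _] pp0].
case: ifPn => // rlp; case/eqP: pp0; apply/val_inj/(inj_map val_inj).
rewrite /= p0E; apply: (sorted_eq geq_trans geq_anti) => //.
  by apply: sort_sorted => a b; exact: leq_total.
by rewrite perm_sym; apply: perm_trans rlp; rewrite perm_sym.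
Qed.

(** Each nonempty [S] is counted once on the right, at r = #|S|, M the number of
    its runs, and the partition formed by their lengths. *)
Lemma sum_run_patterns :
  \sum_(S : {set 'I_N} | S != finset.set0) \prod_(A in runs S) F #|A| =
  \sum_(1 <= r < N.+1) \sum_(1 <= M < (minn r (N - r + 1)).+1)
    sum_intparts r M (fun q =>
      (\prod_(1 <= l < N.+1) F l ^+ part_mult q l) *
      (pochhammer (N - r + 2 - M) M /
         \prod_(1 <= l < N.+1) ((part_mult q l)`!)%:R)).
Proof.
transitivity (\sum_(1 <= r < N.+1) \sum_(1 <= M < (minn r (N - r + 1)).+1)
    \sum_(S : {set 'I_N})
      if (r == #|S|) && (M == size (run_lengths S)) then run_product S else 0).
  under [RHS]eq_bigr do rewrite exchange_big.
  rewrite [RHS]exchange_big big_mkcond/=; apply: eq_bigr => S _.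
  rewrite run_productE; case: ifPn => [S0|/negPn/eqP S0]; last first.
    rewrite big1_seq// => r /=; rewrite mem_index_iota => /andP[r0 _].
    by rewrite big1// => M _; rewrite S0 cards0 gtn_eqF.
  have cS : (0 < #|S|)%N by rewrite card_gt0.
  have cN : (#|S| <= N)%N by rewrite -[X in (_ <= X)%N](card_ord N) max_card.
  have mS : (0 < size (run_lengths S))%N.
    by rewrite lt0n; apply: contraTneq cS => /size0nil; rewrite -sumn_run_lengths => ->.
  have mleS : (size (run_lengths S) <= #|S|)%N.
    rewrite -sumn_run_lengths; move: (run_lengths_pos S).
    elim: (run_lengths S) => [//|l q IH] /= /andP[l0 /IH].
    by rewrite -add1n; exact: leq_add.
  rewrite (bigD1_seq #|S|) ?iota_uniq ?mem_index_iota ?cS//=.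
  rewrite [X in _ + X]big1 ?addr0; last first.
    by move=> r /negbTE rS; rewrite big1// => M _; rewrite rS.
  rewrite (bigD1_seq (size (run_lengths S))) ?iota_uniq//=; last first.
    by rewrite mem_index_iota mS ltnS leq_min mleS addn1 size_run_lengths.
  rewrite !eqxx big1 ?addr0// => M /negbTE ->.
  by rewrite andbF.
apply: eq_big_nat => r /andP[r0 rN]; apply: eq_big_nat => M /andP[M0 MrN].
rewrite /sum_intparts.
under eq_bigr do rewrite -sum_one_partition.
rewrite exchange_big/=; apply: eq_bigr => p /and3P[_ ppos /eqP pr].
rewrite partition_term//.
- by rewrite -big_mkcond.
- by rewrite size_map size_tuple.
- by move: MrN; rewrite ltnS leq_min => /andP[].
Qed.

End sum_over_partitions.

(** * The conditional distribution of the run statistic *)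

Theorem mainTheorem2 (R : realType) (d : measure_display)
    (Omega : measurableType d) (P : probability Omega R)
    (N : nat) (hN : (1 <= N)%N)
    (mu sigma : 'I_N -> R) (hsigma : forall i, 0 < sigma i)
    (X : 'I_N -> {RV P >-> R})
    (hindep : mutually_independent X)
    (hnormal : forall i, normally_distributed (X i) (mu i) (sigma i))
    (t : R) (ht : 0 < t) :
  cond_prob P
    [set w | run_stat (fun i => X i w) mu sigma < t]
    [set w | exists i, success (fun j => X j w) mu i] =
  \sum_(1 <= r < N.+1)
   \sum_(1 <= M < (minn r (N - r + 1)).+1)
    sum_intparts r M (fun pi =>
      (\prod_(1 <= l < N.+1)
         (lower_gamma (l%:R / 2) (t / 2) / Gamma (l%:R / 2)) ^+ part_mult pi l)
      * (pochhammer (N - r + 2 - M) M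
         / ((2 ^+ N - 1) * \prod_(1 <= l < N.+1) ((part_mult pi l)`!)%:R))).
Proof.
rewrite (cond_prob_runs hsigma hindep hnormal ht) sum_run_patterns.
rewrite mulr_suml; apply: eq_bigr => r _.
rewrite mulr_suml; apply: eq_bigr => M _.
rewrite /sum_intparts mulr_suml; apply: eq_bigr => p _.
by rewrite -!mulrA; congr (_ * (_ * (_ * _))); rewrite invfM mulrC.
Qed.
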